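(* Let $m,n\geq 1$ be integers. If the homotopy group $\pi_m(\mathbb{S}^n)$ is rank-essential, then $\pi_m^{\mathrm{Lip}}(\mathbb{H}_n)\neq\{0\}$.
   Context: $\mathbb{S}^n$ is the unit sphere in $\mathbb{R}^{n+1}$, $\mathbb{B}^{m+1}$ is the closed unit ball in $\mathbb{R}^{m+1}$, and $\partial\mathbb{B}^{m+1}=\mathbb{S}^m$. Rank-essential: $\pi_m(\mathbb{S}^n)$ is called rank-essential if there is $f\in C^\infty(\mathbb{S}^m,\mathbb{S}^n)$ such that for every Lipschitz map $F:\mathbb{B}^{m+1}\to\mathbb{R}^{n+1}$ with $F|_{\partial\mathbb{B}^{m+1}}=f$ one has $\operatorname{rank} dF=n+1$ on a set of positive ($(m+1)$-dimensional Lebesgue) measure. Heisenberg group: $\mathbb{H}_n$ is $\mathbb{R}^{2n+1}=\mathbb{C}^n\times\mathbb{R}$, with coordinates $(z,t)=(x_1,y_1,\ldots,x_n,y_n,t)$ and group law $(z,t)*(z',t')=(z+z',\,t+t'+2\,\mathrm{Im}\sum_{j=1}^n z_j\overline{z_j'})$. The left-invariant vector fields $X_j=\partial_{x_j}+2y_j\partial_t$, $Y_j=\partial_{y_j}-2x_j\partial_t$ ($j=1,\ldots,n$) span the horizontal distribution, which carries the left-invariant metric making $X_1,Y_1,\ldots,X_n,Y_n$ orthonormal. An absolutely continuous curve is horizontal if its derivative lies in the horizontal distribution almost everywhere. $\mathbb{H}_n$ is regarded as a metric space with the Carnot–Carathéodory metric $d_{cc}$, where $d_{cc}(p,q)$ is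 the infimum of lengths of horizontal curves joining $p$ to $q$. Lipschitz homotopy groups: for a metric space $X$, $\pi_m^{\mathrm{Lip}}(X)$ is defined exactly as the classical homotopy group $\pi_m(X)$, except that both the maps (from $\mathbb{S}^m$ to $X$) and the homotopies between them are required to be Lipschitz. *)

(* Defs.v *)
From HB Require Import structures.
From mathcomp Require Import all_boot all_order all_algebra.
From mathcomp Require Import all_classical all_reals all_analysis.

Set Implicit Arguments.
Unset Strict Implicit.
Unset Printing Implicit Defensive.

Import Order.TTheory GRing.Theory Num.Theory.
Import numFieldNormedType.Exports.

Local Open Scope classical_set_scope.
Local Open Scope ring_scope.

(** The library norm on ['rV[R]_d] is the sup norm, which induces the usual
    topology; the Euclidean norm and distance are introduced separately. *)

Definition eucl_norm (R : realType) (d : nat) (x : 'rV[R]_d) : R :=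
  Num.sqrt (\sum_i x ord0 i ^+ 2).

Definition eucl_dist (R : realType) (d : nat) (x y : 'rV[R]_d) : R := eucl_norm (x - y).

(** [unit_sphere R d] is S^d and [unit_ball R d] is B^(d+1): both live in
    R^(d+1). *)
Definition unit_sphere (R : realType) (d : nat) : set 'rV[R]_d.+1 :=
  [set x | eucl_norm x = 1].

Definition unit_ball (R : realType) (d : nat) : set 'rV[R]_d.+1 :=
  [set x | eucl_norm x <= 1].

Arguments unit_sphere : clear implicits.
Arguments unit_ball : clear implicits.

(** Target distances are extended-real valued, so that an infimum such as
    [dcc] below can be used without proving beforehand that it is finite. *)
Definition lipschitz_wrt (R : realType) (X Y : Type) (dX : X -> X -> R)
    (dY : Y -> Y -> \bar R) (A : set X) (f : X -> Y) : Prop :=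
  exists L : R, forall x y, A x -> A y -> (dY (f x) (f y) <= (L * dX x y)%:E)%E.

Definition box (R : realType) (d : nat) (B : 'rV[R]_d * 'rV[R]_d) :
    set 'rV[R]_d :=
  [set x | forall i, B.1 ord0 i <= x ord0 i <= B.2 ord0 i].

Definition box_volume (R : realType) (d : nat) (B : 'rV[R]_d * 'rV[R]_d) : R :=
  \prod_i Num.max 0 (B.2 ord0 i - B.1 ord0 i).

(** Lebesgue outer measure on R^d; it coincides with the Lebesgue measure on
    measurable sets. *)
Definition lebesgue_outer (R : realType) (d : nat) (A : set 'rV[R]_d) :
    \bar R :=
  ereal_inf [set (\sum_(0 <= k <oo) (box_volume (B k))%:E)%E
            | B in [set B : nat -> 'rV[R]_d * 'rV[R]_d
                   | A `<=` \bigcup_k box (B k)]].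

Definition iter_partial (R : realType) (d k : nat) (s : seq 'I_d)
    (g : 'rV[R]_d -> 'rV[R]_k) : 'rV[R]_d -> 'rV[R]_k :=
  foldr (fun i h x => 'D_(delta_mx ord0 i) h x) g s.

(** C^infinity on an open set: all iterated partial derivatives exist and are
    continuous. *)
Definition smooth_on (R : realType) (d k : nat) (U : set 'rV[R]_d)
    (g : 'rV[R]_d -> 'rV[R]_k) : Prop :=
  forall (s : seq 'I_d) (x : 'rV[R]_d), U x ->
    {for x, continuous (iter_partial s g)} /\
    forall i : 'I_d, derivable (iter_partial s g) x (delta_mx ord0 i).

(** A map between spheres, seen as submanifolds of Euclidean spaces, is smooth
    when near each point it is the restriction of a smooth map of the ambient
    spaces.  The values of [f] off the sphere are irrelevant. *)
Definition smooth_sphere_map (R : realType) (m n : nat)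
    (f : 'rV[R]_m.+1 -> 'rV[R]_n.+1) : Prop :=
  (forall x, unit_sphere R m x -> unit_sphere R n (f x)) /\
  forall x, unit_sphere R m x ->
    exists (U : set 'rV[R]_m.+1) (g : 'rV[R]_m.+1 -> 'rV[R]_n.+1),
      [/\ open U, U x, smooth_on U g &
          forall y, U y -> unit_sphere R m y -> g y = f y].

(** The derivative is only considered in the open ball, where it does not depend
    on the values of [F] outside the closed ball; the boundary sphere is
    negligible.  Differentiability is required explicitly because ['J F x] is
    an arbitrary value where [F] is not differentiable. *)
Definition full_rank_set (R : realType) (m n : nat)
    (F : 'rV[R]_m.+1 -> 'rV[R]_n.+1) : set 'rV[R]_m.+1 :=
  [set x | [/\ eucl_norm x < 1, differentiable F x & \rank ('J F x) = n.+1]].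

Definition rank_essential (R : realType) (m n : nat) : Prop :=
  exists f : 'rV[R]_m.+1 -> 'rV[R]_n.+1,
    smooth_sphere_map f /\
    forall F : 'rV[R]_m.+1 -> 'rV[R]_n.+1,
      lipschitz_wrt (@eucl_dist R m.+1) (fun y z => (eucl_dist y z)%:E)
        (unit_ball R m) F ->
      (forall x, unit_sphere R m x -> F x = f x) ->
      (0 < lebesgue_outer (full_rank_set F))%E.

(** The Heisenberg group, with [(x, y, t)] standing for
    [(x_1, y_1, ..., x_n, y_n, t)]. *)
Notation heis R n := ('rV[R]_n * 'rV[R]_n * R^o)%type.

Definition heis_X (R : realType) (n : nat) (p : heis R n) (j : 'I_n) :
    heis R n :=
  (delta_mx ord0 j, 0, 2 * p.1.2 ord0 j).

Definition heis_Y (R : realType) (n : nat) (p : heis R n) (j : 'I_n) :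
    heis R n :=
  (0, delta_mx ord0 j, - 2 * p.1.1 ord0 j).

Definition heis_frame (R : realType) (n : nat) (p : heis R n)
    (a b : 'rV[R]_n) : heis R n :=
  \sum_j (a ord0 j *: heis_X p j + b ord0 j *: heis_Y p j).

Definition horizontal (R : realType) (n : nat) (p v : heis R n) : Prop :=
  exists a b : 'rV[R]_n, v = heis_frame p a b.

(** Length of a horizontal vector for the metric making the frame
    [heis_X, heis_Y] orthonormal: the coefficients of a horizontal vector in the
    frame are its [x] and [y] components, see [heis_norm_frame]. *)
Definition heis_norm (R : realType) (n : nat) (v : heis R n) : R :=
  Num.sqrt (\sum_j (v.1.1 ord0 j ^+ 2 + v.1.2 ord0 j ^+ 2)).

Lemma heis_norm_frame (R : realType) (n : nat) (p : heis R n)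
    (a b : 'rV[R]_n) :
  heis_norm (heis_frame p a b) =
  Num.sqrt (\sum_j (a ord0 j ^+ 2 + b ord0 j ^+ 2)).
Proof.
have fstE : (heis_frame p a b).1.1 = a.
  rewrite [RHS]row_sum_delta /heis_frame.
  rewrite (big_morph (fun v : heis R n => v.1.1) (id1 := 0) (op1 := +%R)) //.
  by apply: eq_bigr => j _ /=; rewrite scaler0 addr0.
have sndE : (heis_frame p a b).1.2 = b.
  rewrite [RHS]row_sum_delta /heis_frame.
  rewrite (big_morph (fun v : heis R n => v.1.2) (id1 := 0) (op1 := +%R)) //.
  by apply: eq_bigr => j _ /=; rewrite scaler0 add0r.
by rewrite /heis_norm fstE sndE.
Qed.

Definition abs_continuous_on (R : realType) (V : normedModType R) (a b : R)
    (c : R -> V) : Prop :=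
  forall e : R, 0 < e -> exists2 d : R, 0 < d &
    forall (N : nat) (u v : 'I_N -> R),
      (forall i, a <= u i /\ u i <= v i /\ v i <= b) ->
      (forall i j, i != j -> v i <= u j \/ v j <= u i) ->
      \sum_i (v i - u i) < d -> \sum_i `|c (v i) - c (u i)| < e.

Definition horizontal_curve (R : realType) (n : nat) (a b : R)
    (c : R -> heis R n) : Prop :=
  abs_continuous_on a b c /\
  {ae @lebesgue_measure R, forall s : R, a < s < b ->
     derivable c s 1 /\ horizontal (c s) (derive1 c s)}.

Definition curve_length (R : realType) (n : nat) (a b : R)
    (c : R -> heis R n) : \bar R :=
  (\int[@lebesgue_measure R]_(s in `]a, b[%classic)
     (heis_norm (derive1 c s))%:E)%E.

(** The Carnot-Caratheodory distance. *)
Definition dcc (R : realType) (n : nat) (p q : heis R n) : \bar R :=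
  ereal_inf [set l : \bar R | exists (a b : R) (c : R -> heis R n),
    [/\ a < b, horizontal_curve a b c, c a = p, c b = q &
        l = curve_length a b c]].

Definition sphere_base (R : realType) (m : nat) : 'rV[R]_m.+1 :=
  delta_mx ord0 ord0.

Arguments sphere_base : clear implicits.

Definition cyl_dist (R : realType) (m : nat) (u v : 'rV[R]_m.+1 * R) : R :=
  Num.sqrt (eucl_dist u.1 v.1 ^+ 2 + (u.2 - v.2) ^+ 2).

Definition based_lip_map (R : realType) (X : Type) (dX : X -> X -> \bar R)
    (m : nat) (x0 : X) (f : 'rV[R]_m.+1 -> X) : Prop :=
  lipschitz_wrt (@eucl_dist R m.+1) dX (unit_sphere R m) f /\
  f (sphere_base R m) = x0.

Definition based_lip_homotopic (R : realType) (X : Type)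
    (dX : X -> X -> \bar R) (m : nat) (x0 : X) (f g : 'rV[R]_m.+1 -> X) :
    Prop :=
  exists H : 'rV[R]_m.+1 * R -> X,
    [/\ lipschitz_wrt (@cyl_dist R m) dX (unit_sphere R m `*` `[0, 1]) H,
        forall x, unit_sphere R m x -> H (x, 0) = f x,
        forall x, unit_sphere R m x -> H (x, 1) = g x &
        forall t, 0 <= t <= 1 -> H (sphere_base R m, t) = x0].

Definition lip_class (R : realType) (X : Type) (dX : X -> X -> \bar R)
    (m : nat) (x0 : X) (f : 'rV[R]_m.+1 -> X) : set ('rV[R]_m.+1 -> X) :=
  [set g | based_lip_map dX x0 g /\ based_lip_homotopic dX x0 f g].

(** The elements of the m-th Lipschitz homotopy group of [(X, dX)] at [x0],
    as a set of classes; [pi_lip0] is its neutral element.  Maps are defined on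
    the ambient space, but only their values on the sphere matter. *)
Definition pi_lip (R : realType) (X : Type) (dX : X -> X -> \bar R)
    (m : nat) (x0 : X) : set (set ('rV[R]_m.+1 -> X)) :=
  [set lip_class dX x0 f | f in [set f | based_lip_map dX x0 f]].

Definition pi_lip0 (R : realType) (X : Type) (dX : X -> X -> \bar R)
    (m : nat) (x0 : X) : set ('rV[R]_m.+1 -> X) :=
  lip_class dX x0 (fun=> x0).

Arguments pi_lip {R X} dX m x0.
Arguments pi_lip0 {R X} dX m x0.

(* Main.v *)
Require Import Defs.
From mathcomp Require Import all_boot all_order all_algebra.
From mathcomp Require Import all_classical all_reals all_analysis.
From mathcomp Require Import measurable_realfun ring lra.

Set Implicit Arguments.
Unset Strict Implicit.
Unset Printing Implicit Defensive.

Import Order.TTheory GRing.Theory Num.Theory.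
Import numFieldNormedType.Exports.

Local Open Scope classical_set_scope.
Local Open Scope ring_scope.

(** The argument rests on an explicit Legendrian sphere.  Write a point of S^n
    as (a, X) with a real and X in R^n.  The map
      [legendre_sphere] : (a, X) |-> (X, a X, - 2 (a - a^3 / 3))
    lifts the Whitney immersion of S^n into C^n; it is tangent to the
    horizontal distribution, because |X|^2 = 1 - a^2, and it has a left inverse
    defined on the whole group, the polynomial map
      [heis_proj] : (x, y, t) |-> (- (3 t / 4 + x . y / 2), x).

    Let f : S^m -> S^n be the map given by rank-essentiality.  After a left
    translation, which adjusts the base point, [legendre_sphere] composed with f
    is Lipschitz for the Carnot-Caratheodory distance: two points of S^m are
    joined by a great circle, whose image is a horizontal curve of comparable
    length ([legendre_sphere_lipschitz]).  If the homotopy group were trivial,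
    this map would be null-homotopic, hence would extend to a Lipschitz map G of
    the ball into the Heisenberg group ([cone_of_null_homotopy]).  Undoing the
    translation and applying [heis_proj] gives a Lipschitz extension F of f to
    the ball, with values in R^(n+1).

    The contradiction comes from [rank_jacobian_heis_proj]: dF has rank less
    than n + 1 at every point where F is differentiable, so that the full-rank
    set of F is empty.  A Lipschitz map into the Heisenberg group moves the
    vertical coordinate of p^-1 * q only to second order,
    |[heis_twist] p q| <= C d(p, q)^2 ([dcc_lt_bounds]).  Modulo second-order
    terms, the increment of the first component of F at x is
    therefore U . dy - 2 V . dx, where x and y stand for the horizontal
    coordinates of G and (U, V) for their values at x.  If dF were onto, some
    plane of directions, with coordinates (alpha, kappa), would satisfy
    dx = alpha U and U . dy = kappa, up to o(h).  Along a closed polygon in that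
    plane the twists add up to the integral of y dx - x dy, up to the factor
    - 2; at scale s this integral is, up to sign and o(s^2), twice the area
    enclosed by the polygon, hence of exact order s^2.  Subdividing each side
    into N pieces makes the sum of the twists O(s^2 / N), which is impossible
    ([no_area_potential]).

    The bound on the twist needs a fundamental theorem of calculus for
    absolutely continuous curves, in the form of an upper bound on increments
    ([ac_norm_increment_le_integral]). *)

(** * Increments of absolutely continuous functions *)

Lemma open_norm_ball (R : realType) (V : normedModType R) (U : set V) (x : V) :
  open U -> U x -> exists2 r : R, 0 < r & forall y, `|y - x| < r -> U y.
Proof.
move=> oU Ux; have /nbhs_ballP[r /= r0 Hr] := open_nbhs_nbhs (conj oU Ux).
by exists r => // y yr; apply: Hr; rewrite -ball_normE/ball_/= distrC.
Qed.

(** The integral of a nonnegative function is a supremum over the simple functions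
    below it, whence monotonicity without any measurability assumption.  This
    matters because [curve_length] integrates a speed that is arbitrary where
    the curve is not derivable. *)
Lemma le_ge0_integral d (T : measurableType d) (R : realType)
    (mu : {measure set T -> \bar R}) (A B : set T) (f g : T -> \bar R) :
  (forall x, A x -> (0 <= f x)%E) -> (forall x, B x -> (0 <= g x)%E) ->
  (forall x, A x -> B x /\ (f x <= g x)%E) ->
  (\int[mu]_(x in A) f x <= \int[mu]_(x in B) g x)%E.
Proof.
move=> f0 g0 fg; rewrite !ge0_integralE//; apply: le_ereal_sup => _ [h hf <-].
exists h => // x; apply: le_trans (hf x) _; rewrite /patch.
case: ifPn => [/set_mem Ax|_].
  by have [Bx fgx] := fg x Ax; rewrite mem_set.
by case: ifPn => // /set_mem/g0.
Qed.

(** Cousin's lemma, in the form of an induction along [[a, b]]: a property that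
    can be carried over every short interval around each point reaches [b]. *)
Lemma cousin (R : realType) (a b : R) (Q : R -> Prop) :
  a <= b -> Q a ->
  (forall x, a <= x <= b -> exists2 d : R, 0 < d & forall s s',
     a <= s -> s <= x -> x <= s' -> s' <= b -> x - d < s -> s' < x + d ->
     Q s -> Q s') ->
  Q b.
Proof.
move=> ab Qa step.
pose S := [set s | a <= s <= b /\ Q s].
have S0 : S !=set0 by exists a; split; rewrite ?lexx ?ab.
have Sub : ubound S b by move=> s [/andP[]].
have hS : has_sup S by split => //; exists b.
pose c := sup S.
have cb : c <= b by apply: ge_sup.
have ac : a <= c by apply: (ub_le_sup hS.2); split; rewrite ?lexx ?ab.
have [d d0 Hd] := step c (introT andP (conj ac cb)).
have [s [/andP[as_ sb] Qs] cs] := sup_adherent d0 hS.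
have sc : s <= c by apply: (ub_le_sup hS.2); split; rewrite ?as_.
have Qc : Q c by apply: (Hd s c) => //; rewrite ltrDl.
case: (ltP c b) => [cltb|]; last by move=> bc; rewrite (le_anti (introT andP (conj bc cb))).
pose c' := Num.min b (c + d / 2).
have c'1 : c < c' by rewrite /c' lt_min cltb/= ltrDl divr_gt0.
have c'b : c' <= b by rewrite /c' ge_min lexx.
have : c' <= c.
  apply: (ub_le_sup hS.2); split; first by rewrite c'b (le_trans ac (ltW c'1)).
  apply: (Hd c c') => //; first exact: ltW.
    by rewrite ltrBlDr ltrDl.
  by rewrite /c' gt_min; apply/orP; right; rewrite ltrD2l ltr_pdivrMr// ltr_pMr// ltr1n.
by rewrite leNgt c'1.
Qed.

Lemma derivable_lin_approx (R : realType) (V : normedModType R) (f : R -> V)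
    (x : R) : derivable f x 1 ->
  forall e : R, 0 < e -> exists2 d : R, 0 < d & forall y, `|y - x| < d ->
    `|f y - f x - (y - x) *: derive1 f x| <= e * `|y - x|.
Proof.
move=> /derivableP fx e e0.
have := @ex_derive _ _ _ _ _ _ _ fx; rewrite /derivable => /cvg_ex [l].
move=> cl.
have lE : derive1 f x = l by rewrite derive1E /derive; apply/cvg_lim.
move/cvgrPdist_le : cl => /(_ _ e0) [d /= d0 Hd].
exists d => // y yd; have [->|yx] := eqVneq y x.
  by rewrite !subrr scale0r subr0 !normr0 mulr0.
have := Hd (y - x); rewrite /ball_/= sub0r normrN => /(_ yd).
rewrite subr_eq0 => /(_ yx).
rewrite lE [(y - x) *: 1]mulr1 subrK => H.
have yx0 : y - x != 0 by rewrite subr_eq0.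
rewrite -(scale1r (f y - f x)) -(divff yx0) -scalerA -scalerBr normrZ mulrC.
by rewrite ler_wpM2r// distrC.
Qed.

(** Comparison of derivatives almost everywhere.  The exceptional null set is
    covered by an open set [W] of small measure.  Going from [a] to [b] by
    [cousin], a short step around a point of [W] lies in [W] and is recorded in
    a list; a short step around any other point obeys the inequality up to [e]
    times its length.  The recorded intervals are disjoint with total length less than
    the measure of [W], so that absolute continuity bounds their contribution.
    Only monotonicity of [phi] is used on them. *)
Lemma ac_le_nondecreasing (R : realType) (a b : R) (h phi : R -> R) :
  a <= b -> abs_continuous_on a b h ->
  (forall s s', a <= s -> s <= s' -> s' <= b -> phi s <= phi s') ->
  {ae @lebesgue_measure R, forall s, a < s < b ->
     [/\ derivable h s 1, derivable phi s 1 & derive1 h s <= derive1 phi s]} ->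
  h b - h a <= phi b - phi a.
Proof.
move=> ab ach ndphi [N [mN N0 HN]].
apply/ler_addgt0Pl => e' e'0.
set mu := @lebesgue_measure R in N0.
(* The total error is [e] per unit length plus [e] for the recorded intervals. *)
pose e := e' / (b - a + 1).
have ba1 : 0 < b - a + 1 by rewrite ltr_wpDl// subr_ge0.
have e0 : 0 < e by rewrite divr_gt0.
have [d d0 Hd] := ach _ e0.
(* The end points join the exceptional set, since derivability is assumed only inside. *)
pose N' := N `|` ([set a] `|` [set b]).
have mN' : measurable N' by apply: measurableU => //; apply: measurableU.
have N'0 : mu N' = 0%E.
  apply/eqP; rewrite eq_le measure_ge0 andbT.
  apply: le_trans (measureU2 _ _ _) _ => //; first exact: measurableU.
  rewrite [X in (X + _)%E]N0 add0e; apply: le_trans (measureU2 _ _ _) _ => //.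
  have E1 (r : R) : mu [set r] = 0%E by exact: lebesgue_measure_set1.
  by rewrite [X in (X + _)%E]E1 [X in (_ + X)%E]E1 adde0.
have [W [oW NW muW]] : exists W, [/\ open W, N' `<=` W & (mu (W `\` N') < d%:E)%E].
  by apply: lebesgue_regularity_outer => //; rewrite [X in (X < _)%E]N'0 ltry.
have mW : measurable W by exact: open_measurable.
have muWd : (mu W < d%:E)%E.
  apply: le_lt_trans muW.
  rewrite -{1}(setDUK NW) (le_trans (measureU2 _ _ _))//.
    exact: measurableD.
  by rewrite [X in (X + _)%E]N'0 add0e.
have step' (s s' : R) : a <= s -> s <= s' -> `]s, s']%classic `<=` W ->
    (mu (W `&` `]a, s]%classic) + (s' - s)%:E <= mu (W `&` `]a, s']%classic))%E.
  move=> as_ ss' sO.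
  have -> : (s' - s)%:E = mu `]s, s']%classic.
    rewrite /mu lebesgue_measure_itv/= lte_fin; case: ltgtP ss' => // ->.
    by rewrite subrr.
  rewrite -measureU//; last 2 first.
  - exact: measurableI.
  - rewrite -subset0 => x [[_ /=]]; rewrite !in_itv/= => /andP[_ xs] /andP[sx _].
    by move: (le_lt_trans xs sx); rewrite ltxx.
  - apply: le_measure; rewrite ?inE.
    + by apply: measurableU => //; exact: measurableI.
    + exact: measurableI.
    + move=> x [[Wx]|sx]; rewrite /= in_itv/=.
        by move=> /andP[ax xs]; split => //; rewrite /= in_itv/= ax (le_trans xs).
      split; first exact: sO.
      move: sx; rewrite /= !in_itv/= => /andP[sx ->]; rewrite andbT.
      exact: le_lt_trans sx.
(* [l] lists the recorded intervals, the most recent one first. *)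
pose Q s := exists l : seq (R * R),
  [/\ forall p, p \in l -> [/\ a <= p.1, p.1 <= p.2 & p.2 <= s],
      pairwise (fun p q => q.2 <= p.1) l,
      ((\sum_(p <- l) (p.2 - p.1))%:E <= mu (W `&` `]a, s]%classic))%E &
      h s - h a <= phi s - phi a + e * (s - a) + \sum_(p <- l) `|h p.2 - h p.1| ].
have Qb : Q b.
  apply: (cousin (a := a)) => //.
    exists [::]; split => //; first by rewrite big_nil measure_ge0.
    by rewrite big_nil !subrr mulr0 !addr0.
  move=> x /andP[ax xb]; have [Wx|Wx] := pselect (W x).
    have [r r0 Hr] := open_norm_ball oW Wx.
    exists r => // s s' as_ sx xs' s'b xrs s'xr [l [l1 l2 l3 l4]].
    exists ((s, s') :: l); split.
    - move=> p; rewrite inE => /orP[/eqP ->/=|/l1[? ? ps]]; last first.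
        by split => //; rewrite (le_trans ps)// (le_trans sx).
      by split => //; exact: le_trans xs'.
    - rewrite /= l2 andbT; apply/allP => q /l1[_ _] /=.
      by [].
    - rewrite big_cons/= addrC EFinD; apply: le_trans; last first.
        apply: (step' s s') => //; first exact: le_trans xs'.
        move=> y; rewrite /= in_itv/= => /andP[sy ys']; apply: Hr.
        by rewrite ltr_norml; apply/andP; split; lra.
      exact: leeD2r.
    - rewrite big_cons/=.
      have ss' : s <= s' by exact: le_trans xs'.
      have := ndphi _ _ as_ ss' s'b.
      have := ler_norm (h s' - h s).
      have : 0 <= e * (s' - s) by rewrite mulr_ge0 ?subr_ge0// ltW.
      lra.
  have nN x' : ~ W x' -> ~ N x' by move=> nW Nx; apply: nW; apply: NW; left.
  have [hx phx hphi] : [/\ derivable h x 1, derivable phi x 1 & derive1 h x <= derive1 phi x].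
    have ax' : a < x.
      rewrite lt_neqAle ax andbT; apply/eqP => xa; apply: Wx; apply: NW.
      by right; left; rewrite /= xa.
    have xb' : x < b.
      rewrite lt_neqAle xb andbT; apply/eqP => xa; apply: Wx; apply: NW.
      by right; right.
    apply: contrapT => H; apply: (nN _ Wx); apply: HN => /= K; apply: H.
    by apply: K; rewrite ax'.
  have e20 : 0 < e / 2 by rewrite divr_gt0.
  have [d1 d10 H1] := derivable_lin_approx hx e20.
  have [d2 d20 H2] := derivable_lin_approx phx e20.
  exists (Num.min d1 d2); first by rewrite lt_min d10.
  move=> s s' as_ sx xs' s'b xrs s'xr [l [l1 l2 l3 l4]].
  have ss' : s <= s' by exact: le_trans xs'.
  exists l; split => //.
  - by move=> p /l1[? ? ?]; split => //; exact: le_trans ss'.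
  - apply: (le_trans l3); apply: le_measure; rewrite ?inE; [exact: measurableI..|].
    move=> y [Wy] /=; rewrite !in_itv/= => /andP[ay ys]; split => //=.
    by rewrite ?in_itv/= ay (le_trans ys).
  - have K y : `|y - x| < Num.min d1 d2 ->
      `|(h y - phi y) - (h x - phi x) - (y - x) * (derive1 h x - derive1 phi x)| <= e * `|y - x|.
      rewrite lt_min => /andP[/H1 h1 /H2 h2].
      rewrite [leLHS](_ : _ = `|(h y - h x - (y - x) *: derive1 h x) -
         (phi y - phi x - (y - x) *: derive1 phi x)|); last first.
        by congr `|_|; rewrite /GRing.scale/=; ring.
      apply: le_trans (ler_normB _ _) _; lra.
    have Ks : `|s - x| < Num.min d1 d2.
      by rewrite ltr_distl xrs (le_lt_trans sx)// ltrDl lt_min d10.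
    have Ks' : `|s' - x| < Num.min d1 d2.
      by rewrite ltr_distl s'xr (lt_le_trans _ xs')// ltrBlDr ltrDl lt_min d10.
    move: (K _ Ks) (K _ Ks'); rewrite !ler_norml => /andP[K1 _] /andP[_ K2].
    move: K1 K2; rewrite (ler0_norm (_ : s - x <= 0)) ?subr_le0//.
    rewrite (ger0_norm (_ : 0 <= s' - x)) ?subr_ge0//.
    move=> K1 K2.
    have M1 : 0 <= (s' - x) * (derive1 phi x - derive1 h x) by rewrite mulr_ge0 ?subr_ge0.
    have M2 : 0 <= (x - s) * (derive1 phi x - derive1 h x) by rewrite mulr_ge0 ?subr_ge0.
    lra.
case: Qb => l [l1 l2 l3 l4].
have Sd : \sum_(p <- l) (p.2 - p.1) < d.
  rewrite -lte_fin; apply: le_lt_trans muWd; apply: le_trans l3 _.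
  by apply: le_measure; rewrite ?inE//; exact: measurableI.
have Se : \sum_(p <- l) `|h p.2 - h p.1| < e.
  rewrite (big_nth (0, 0)) big_mkord.
  apply: (Hd (size l) (fun i => (nth (0,0) l i).1) (fun i => (nth (0,0) l i).2)).
  - by move=> i; have [? ? ?] := l1 _ (mem_nth (0, 0) (ltn_ord i)).
  - move=> i j ij.
    have P (i0 j0 : 'I_(size l)) : (i0 < j0)%N -> (nth (0,0) l j0).2 <= (nth (0,0) l i0).1.
      by move=> ltij; apply: (pairwiseP (0,0) l2) => //; rewrite inE.
    case: (ltngtP i j) => [/P|/P|eij]; [by right|by left|].
    by move: ij; rewrite (val_inj eij) eqxx.
  - by move: Sd; rewrite (big_nth (0, 0)) big_mkord.
have : e * (b - a) + e <= e'.
  by rewrite -{2}(mulr1 e) -mulrDr /e divfK// gt_eqF.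
lra.
Qed.

Lemma clamp_nonexpansive (R : realType) (a b s t : R) : a <= b -> s <= t ->
  let c x := Num.max a (Num.min b x) in c s <= c t /\ c t - c s <= t - s.
Proof.
move=> ab st /=; rewrite /Num.max /Num.min.
by case: (ltP b s); case: (ltP b t) => ? ?; do ![case: ltP => ?]; split; lra.
Qed.

(** Composing with the retraction of the line onto [[a, b]] gives a globally
    continuous function, whose difference quotients are Borel. *)
Lemma abs_continuous_clamp (R : realType) (a b : R) (h : R -> R) : a <= b ->
  abs_continuous_on a b h ->
  continuous (fun s => h (Num.max a (Num.min b s))).
Proof.
move=> ab ach x.
apply/cvgrPdist_lt => e e0.
have [d d0 Hd] := ach _ e0.
pose c s := Num.max a (Num.min b s).
have cab s : a <= c s /\ c s <= b.
  by rewrite /c le_max lexx ge_max ab ge_min lexx.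
have main s t : s <= t -> t - s < d -> `|h (c t) - h (c s)| < e.
  move=> st tsd; have [c1 c2] := clamp_nonexpansive ab st.
  have := Hd 1%N (fun=> c s) (fun=> c t); rewrite !big_ord1; apply.
  - by move=> _; rewrite c1 (cab _).1 (cab _).2.
  - by move=> i j; rewrite !ord1.
  - exact: le_lt_trans tsd.
near=> y.
have xyd : `|x - y| < d.
  by near: y; apply/nbhs_ballP; exists d => //= y.
change (`|h (c x) - h (c y)| < e); have [xy|yx] := leP x y.
  rewrite distrC; apply: main => //.
  by move: xyd; rewrite distrC ger0_norm ?subr_ge0.
apply: main; first exact: ltW.
by move: xyd; rewrite gtr0_norm ?subr_gt0.
Unshelve. all: by end_near. Qed.

Lemma derive1_seq_cvg (R : realType) (f : R -> R) (x : R) : derivable f x 1 ->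
  (k.+1%:R * (f (x + k.+1%:R^-1) - f x)) @[k --> \oo] --> derive1 f x.
Proof.
move=> fx; apply/cvgrPdist_le => e e0.
have [d d0 Hd] := derivable_lin_approx fx e0.
near=> k.
have k0 : 0 < k.+1%:R^-1 :> R by rewrite invr_gt0.
have := Hd (x + k.+1%:R^-1); rewrite (addrC x) addrK gtr0_norm//.
have kd : k.+1%:R^-1 < d.
  by near: k; exact: near_infty_natSinv_lt (PosNum d0).
move=> /(_ kd); rewrite /GRing.scale/= -(addrC x) => H.
rewrite distrC.
have -> : k.+1%:R * (f (x + k.+1%:R^-1) - f x) - derive1 f x =
  k.+1%:R * (f (x + k.+1%:R^-1) - f x - k.+1%:R^-1 * derive1 f x).
  by rewrite [RHS]mulrBr mulrA divff ?mul1r// pnatr_eq0.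
by rewrite normrM ger0_norm// mulrC -ler_pdivlMr.
Unshelve. all: by end_near. Qed.

(** [ac_le_nondecreasing] with [phi] a primitive of [`|h'|], whose derivative
    is given almost everywhere by the Lebesgue differentiation theorem.  Since
    [rho] need not be measurable, it is first replaced by [`|h'|] off a Borel
    null set, where it is a limit of continuous difference quotients. *)
Lemma ac_increment_le_integral (R : realType) (a b : R) (h rho : R -> R) :
  a <= b -> abs_continuous_on a b h -> (forall s, 0 <= rho s) ->
  {ae @lebesgue_measure R, forall s, a < s < b ->
     derivable h s 1 /\ `|derive1 h s| <= rho s} ->
  ((h b - h a)%:E <=
    \int[@lebesgue_measure R]_(s in `]a, b[%classic) (rho s)%:E)%E.
Proof.
move=> ab ach rho0 aeh; have [N [mN N0 HN]] := aeh.
set mu := @lebesgue_measure R in N0 *.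
pose D : set R := `]a, b[%classic `\` N.
have mD : measurable D by apply: measurableD.
have HD s : D s -> [/\ a < s < b, derivable h s 1 & `|derive1 h s| <= rho s].
  move=> [/= /[!in_itv]/= sab sN].
  have [] : derivable h s 1 /\ `|derive1 h s| <= rho s; last by [].
  by apply: contrapT => H; apply: sN; apply: HN => /= K; apply: H; apply: K.
pose hc s := h (Num.max a (Num.min b s)).
have chc : continuous hc by exact: abs_continuous_clamp.
have mh' : measurable_fun D (derive1 h).
  apply: (@measurable_fun_cvg _ _ _ D
     (fun k s => k.+1%:R * (hc (s + k.+1%:R^-1) - hc s))).
    move=> k; apply: measurable_funTS; apply: continuous_measurable_fun => x.
    apply: cvgM; first exact: cvg_cst.
    apply: cvgB; last exact: chc.
    apply: (continuous_cvg _ (chc _)).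
    by apply: cvgD; [exact: cvg_id|exact: cvg_cst].
  move=> s /HD [/andP[as_ sb] dh _].
  have hcE : \forall y \near s, h y = hc y.
    have : \forall y \near s, y \in `]a, b[%R by apply: near_in_itvoo; rewrite in_itv/= as_.
    apply: filterS => y; rewrite in_itv/= => /andP[ay yb].
    by rewrite /hc (min_idPr (ltW yb)) (max_idPr (ltW ay)).
  have <- : derive1 hc s = derive1 h s.
    rewrite !derive1E; apply/esym; exact: near_eq_derive.
  apply: derive1_seq_cvg; move: dh; exact: near_eq_derivable.
pose g := (fun s => `|derive1 h s|) \_ D.
have g0 s : 0 <= g s by rewrite /g patchE; case: ifP.
have mg : measurable_fun setT g.
  apply/(measurable_restrictT _ mD); exact: measurableT_comp.
have Ile : (\int[mu]_s (g s)%:E <=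
    \int[mu]_(s in `]a, b[%classic) (rho s)%:E)%E.
  rewrite -[leLHS](_ : (\int[mu]_(s in D) (`|derive1 h s|)%:E)%E = _); last first.
    rewrite integral_mkcond; apply: eq_integral => s _.
    by rewrite /g !patchE; case: ifP.
  apply: le_ge0_integral => s; rewrite ?lee_fin//.
  by move=> Ds; have [sab _ ?] := HD _ Ds; split; rewrite ?lee_fin//= in_itv.
have [Ioo|Ifin] := leP +oo%E (\int[mu]_s (g s)%:E)%E.
  by apply: le_trans Ile; apply: le_trans Ioo; rewrite leey.
have ig : mu.-integrable setT (EFin \o g).
  apply/integrableP; split; first exact/measurable_EFinP.
  by under eq_integral => s _ do rewrite /= ger0_norm//.
have igy y : mu.-integrable `]-oo, y] (EFin \o g) by exact: integrableS ig.
pose phi y := (\int[mu]_(t in `]-oo, y]%classic) g t)%R.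
have ndphi s s' : s <= s' -> phi s <= phi s'.
  move=> ss'; rewrite /phi /Rintegral fine_le//.
  - exact: integrable_fin_num.
  - exact: integrable_fin_num.
  - apply: le_ge0_integral => x; rewrite ?lee_fin//=.
    by rewrite !in_itv/= => xs; rewrite (le_trans xs).
have phi0 s : 0 <= phi s by apply: Rintegral_ge0 => x _; exact: g0.
have ftc := FTC1Ny igy (open_integrable_locally openT ig).
have H : h b - h a <= phi b - phi a.
  apply: ac_le_nondecreasing => //; first by move=> s s' _ + _; exact: ndphi.
  have aeN : {ae mu, forall s, ~ N s} by exists N; split => // s /=; exact: contrapT.
  apply: (@filterS2 _ _ (ae_filter_ringOfSetsType mu) _ _ _ _ aeN ftc).
  move=> s Ns [dphi phiE] sab.
  have Ds : D s by split; rewrite //= in_itv.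
  have [_ dh _] := HD _ Ds.
  by split => //; rewrite phiE /g patchE mem_set// ler_norm.
apply: le_trans Ile.
have : (phi b)%:E = (\int[mu]_(t in `]-oo, b]%classic) (g t)%:E)%E.
  by rewrite /phi /Rintegral fineK//; exact: integrable_fin_num.
move=> phibE; apply: (@le_trans _ _ (phi b)%:E).
  by rewrite lee_fin (le_trans H)// gerBl.
by rewrite phibE; apply: le_ge0_integral => x; rewrite ?lee_fin.
Qed.

Lemma ac_norm_increment_le_integral (R : realType) (a b : R) (h rho : R -> R) :
  a <= b -> abs_continuous_on a b h -> (forall s, 0 <= rho s) ->
  {ae @lebesgue_measure R, forall s, a < s < b ->
     derivable h s 1 /\ `|derive1 h s| <= rho s} ->
  (`|h b - h a|%:E <=
    \int[@lebesgue_measure R]_(s in `]a, b[%classic) (rho s)%:E)%E.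
Proof.
move=> ab ach rho0 aeh.
have [_|_] := ger0P (h b - h a); first exact: ac_increment_le_integral.
rewrite opprB addrC -[h a]opprK.
apply: (@ac_increment_le_integral _ a b (- h)) => //.
  move=> e /ach[d d0 Hd]; exists d => // k u v uv1 uv2 uvd.
  under eq_bigr do rewrite -normrN opprD !opprK.
  exact: Hd.
apply: (@filterS _ _ (ae_filter_ringOfSetsType _) _ _ _ aeh) => s /[apply] -[dh h'].
split; first exact: derivableN.
by rewrite derive1E deriveN// normrN -derive1E.
Qed.

(** * Horizontal curves and the Carnot-Caratheodory distance *)

(** The vertical coordinate of p^-1 * q.  It vanishes to second order along
    horizontal curves, and is invariant under left translations. *)
Definition heis_twist (R : realType) (n : nat) (p q : heis R n) : R :=
  q.2 - p.2 - 2 * \sum_j (p.1.2 ord0 j * q.1.1 ord0 j - p.1.1 ord0 j * q.1.2 ord0 j).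

(** The frame in coordinates: a horizontal vector at [p] is determined by its
    [x] and [y] parts, the contact form fixing its [t] part. *)
Lemma heis_frameE (R : realType) (n : nat) (p : heis R n) (a b : 'rV[R]_n) :
  heis_frame p a b =
  (a, b, 2 * \sum_j (p.1.2 ord0 j * a ord0 j - p.1.1 ord0 j * b ord0 j)).
Proof.
rewrite /heis_frame.
have E1 : (\sum_j (a ord0 j *: heis_X p j + b ord0 j *: heis_Y p j)).1.1 = a.
  rewrite [RHS]row_sum_delta.
  rewrite (big_morph (fun v : heis R n => v.1.1) (id1 := 0) (op1 := +%R)) //.
  by apply: eq_bigr => j _ /=; rewrite scaler0 addr0.
have E2 : (\sum_j (a ord0 j *: heis_X p j + b ord0 j *: heis_Y p j)).1.2 = b.
  rewrite [RHS]row_sum_delta.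
  rewrite (big_morph (fun v : heis R n => v.1.2) (id1 := 0) (op1 := +%R)) //.
  by apply: eq_bigr => j _ /=; rewrite scaler0 add0r.
have E3 : (\sum_j (a ord0 j *: heis_X p j + b ord0 j *: heis_Y p j)).2 =
  2 * \sum_j (p.1.2 ord0 j * a ord0 j - p.1.1 ord0 j * b ord0 j).
  rewrite (big_morph (fun v : heis R n => v.2) (id1 := 0) (op1 := +%R)) //.
  by rewrite mulr_sumr; apply: eq_bigr => j _ /=; rewrite /GRing.scale/=; ring.
by move: E1 E2 E3; case: (\sum_j _) => [[x y] z] /= -> -> ->.
Qed.

Lemma coord_le_mx_norm (R : realType) (m n : nat) (A : 'M[R]_(m, n)) i j :
  `|A i j| <= `|A|.
Proof.
rewrite [leRHS]/Num.Def.normr/= mx_normrE.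
by apply: le_trans (le_bigmax _ _ (i, j)) => //=.
Qed.

Lemma heis_coord_le_norm (R : realType) (n : nat) (p : heis R n) :
  [/\ forall j, `|p.1.1 ord0 j| <= `|p|, forall j, `|p.1.2 ord0 j| <= `|p| &
      `|p.2| <= `|p|].
Proof.
rewrite prod_normE; split=> [j|j|]; last by rewrite le_max lexx orbT.
  rewrite le_max; apply/orP; left; rewrite prod_normE le_max.
  by rewrite coord_le_mx_norm.
rewrite le_max; apply/orP; left; rewrite prod_normE le_max.
by rewrite coord_le_mx_norm orbT.
Qed.

Lemma coord_le_heis_norm (R : realType) (n : nat) (p : heis R n) (j : 'I_n) :
  `|p.1.1 ord0 j| <= heis_norm p /\ `|p.1.2 ord0 j| <= heis_norm p.
Proof.
have H : p.1.1 ord0 j ^+ 2 + p.1.2 ord0 j ^+ 2 <=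
    \sum_j (p.1.1 ord0 j ^+ 2 + p.1.2 ord0 j ^+ 2).
  rewrite (bigD1 j)//= lerDl; apply: sumr_ge0 => i _.
  by rewrite addr_ge0// sqr_ge0.
by rewrite /heis_norm -!sqrtr_sqr; split; apply: ler_wsqrtr; apply: le_trans H;
  rewrite ?lerDl ?lerDr sqr_ge0.
Qed.

(** The conditions under which a real-valued function commutes with derivation of
    curves.  The functionals of interest are expressions in coordinates rather
    than bundled linear maps. *)
Definition bounded_functional (R : realType) (V : normedModType R) (l : V -> R) :=
  [/\ {morph l : x y / x - y}, forall k x, l (k *: x) = k * l x &
      exists2 K : R, 0 < K & forall x, `|l x| <= K * `|x|].

Lemma bounded_functional_x (R : realType) (n : nat) (j : 'I_n) :
  bounded_functional (fun q : heis R n => q.1.1 ord0 j).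
Proof.
split; [by move=> x y; rewrite !mxE|by move=> k x; rewrite !mxE|].
by exists 1 => // x; rewrite mul1r; have [] := heis_coord_le_norm x.
Qed.

Lemma bounded_functional_y (R : realType) (n : nat) (j : 'I_n) :
  bounded_functional (fun q : heis R n => q.1.2 ord0 j).
Proof.
split; [by move=> x y; rewrite !mxE|by move=> k x; rewrite !mxE|].
by exists 1 => // x; rewrite mul1r; have [] := heis_coord_le_norm x.
Qed.

Lemma bounded_functional_derive (R : realType) (V : normedModType R)
    (l : V -> R) (f : R -> V) (s : R) :
  bounded_functional l -> derivable f s 1 ->
  derivable (l \o f) s 1 /\ derive1 (l \o f) s = l (derive1 f s).
Proof.
move=> [lB lZ [K K0 lK]] fs.
suff C : (fun h => h^-1 *: ((l \o f) (h *: 1 + s) - (l \o f) s)) @ 0^' --> l (derive1 f s).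
  split; first by apply/cvg_ex; eexists; exact: C.
  by rewrite [LHS]derive1E /derive; apply/cvg_lim.
apply/cvgrPdist_le => e e0.
have eK : 0 < e / K by rewrite divr_gt0.
move: fs => /derivableP /@ex_derive; rewrite /derivable => /cvg_ex[x xl].
have xE : derive1 f s = x by rewrite derive1E /derive; apply/cvg_lim.
move/cvgrPdist_le : xl => /(_ _ eK); apply: filterS => h.
rewrite xE /GRing.scale/= -lB -lZ -lB => H.
by apply: le_trans (lK _) _; rewrite mulrC -ler_pdivlMr.
Qed.

(** Estimates on horizontal curves are reduced to the scalar case by testing
    them against linear functionals. *)
Lemma functional_increment_le (R : realType) (n : nat) (a b : R)
    (c : R -> heis R n) (l : heis R n -> R) (rho : R -> R) :
  a <= b -> horizontal_curve a b c -> bounded_functional l ->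
  (forall s, 0 <= rho s) ->
  (forall s, a < s < b -> derivable c s 1 -> horizontal (c s) (derive1 c s) ->
    `|l (derive1 c s)| <= rho s) ->
  (`|l (c b) - l (c a)|%:E <=
    \int[@lebesgue_measure R]_(s in `]a, b[%classic) (rho s)%:E)%E.
Proof.
move=> ab [acc hc] bl rho0 lrho.
apply: (@ac_norm_increment_le_integral _ a b (l \o c)) => //.
  case: bl => [lB lZ [K K0 lK]] e e0.
  have [d d0 Hd] := acc (e / K) (divr_gt0 e0 K0).
  exists d => // k u v uv1 uv2 /(Hd _ _ _ uv1 uv2); rewrite ltr_pdivlMr// mulrC.
  apply: le_lt_trans; rewrite mulr_sumr; apply: ler_sum => i _ /=.
  by rewrite -lB.
apply: (@filterS _ _ (ae_filter_ringOfSetsType _) _ _ _ hc) => s + sab.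
move=> /(_ sab)[ds hs]; have [dl dlE] := bounded_functional_derive bl ds.
by split => //; rewrite dlE; exact: lrho.
Qed.

Lemma horizontal_curve_init (R : realType) (n : nat) (a b s : R)
    (c : R -> heis R n) : s <= b -> horizontal_curve a b c ->
  horizontal_curve a s c.
Proof.
move=> sb [acc hc]; split.
  move=> e /acc[d d0 Hd]; exists d => // N u v uv; apply: Hd => i.
  by have [? [? ?]] := uv i; do !split => //; exact: le_trans sb.
apply: (@filterS _ _ (ae_filter_ringOfSetsType _) _ _ _ hc) => r H /andP[ar rs].
by apply: H; rewrite ar (lt_le_trans rs).
Qed.

(** Up to a constant, [heis_twist p] is a linear functional of its second
    argument. *)
Lemma bounded_functional_twist (R : realType) (n : nat) (p : heis R n) :
  bounded_functional (fun q : heis R n => q.2 -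
    2 * \sum_j (p.1.2 ord0 j * q.1.1 ord0 j - p.1.1 ord0 j * q.1.2 ord0 j)).
Proof.
split.
- move=> x y /=; rewrite [X in 2 * X](_ : _ =
    \sum_j (p.1.2 ord0 j * x.1.1 ord0 j - p.1.1 ord0 j * x.1.2 ord0 j) -
    \sum_j (p.1.2 ord0 j * y.1.1 ord0 j - p.1.1 ord0 j * y.1.2 ord0 j)); last first.
    by rewrite -sumrB; apply: eq_bigr => j _; rewrite !mxE; ring.
  by ring.
- move=> k x /=; rewrite [X in 2 * X](_ : _ =
    k * \sum_j (p.1.2 ord0 j * x.1.1 ord0 j - p.1.1 ord0 j * x.1.2 ord0 j)); last first.
    by rewrite mulr_sumr; apply: eq_bigr => j _; rewrite !mxE; ring.
  by rewrite /GRing.scale/=; ring.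
- pose S := \sum_j (`|p.1.2 ord0 j| + `|p.1.1 ord0 j|).
  have S0 : 0 <= S by apply: sumr_ge0 => j _; rewrite addr_ge0.
  exists (1 + 2 * S) => [|x]; first lra.
  have [x1 x2 x3] := heis_coord_le_norm x.
  have H : `|\sum_j (p.1.2 ord0 j * x.1.1 ord0 j - p.1.1 ord0 j * x.1.2 ord0 j)|
      <= S * `|x|.
    apply: le_trans (ler_norm_sum _ _ _) _; rewrite mulr_suml.
    apply: ler_sum => j _; apply: le_trans (ler_normB _ _) _.
    by rewrite !normrM mulrDl lerD// ler_wpM2l.
  apply: le_trans (ler_normB _ _) _; rewrite normrM ger0_norm//.
  by rewrite [leRHS]mulrDl mul1r lerD// -mulrA ler_wpM2l.
Qed.

(** Take a horizontal curve of length less than [l].  Its [x] and [y]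
    coordinates are at most [l] away from their initial values all along; the
    derivative of the twist from the starting point is bilinear in those
    displacements and in the velocity, so that it is at most a constant times
    [l] times the speed.  Integrating once more gives [l ^+ 2]. *)
Lemma dcc_lt_bounds (R : realType) (n : nat) (p q : heis R n) (l : R) :
  (dcc p q < l%:E)%E ->
  [/\ forall j, `|q.1.1 ord0 j - p.1.1 ord0 j| <= l,
      forall j, `|q.1.2 ord0 j - p.1.2 ord0 j| <= l &
      `|heis_twist p q| <= 4 * n.+1%:R * l ^+ 2].
Proof.
move=> /ereal_inf_lt[_ [a [b [c [ab hc <- <- ->]]]]].
rewrite /curve_length => lenl.
have hn0 s : 0 <= heis_norm (derive1 c s) by exact: sqrtr_ge0.
have l0 : 0 < l.
  rewrite -lte_fin; apply: le_lt_trans lenl; apply: integral_ge0 => s _.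
  by rewrite lee_fin.
have sub s : a <= s -> s <= b ->
    (\int[lebesgue_measure]_(s in `]a, s[%classic) (heis_norm (derive1 c s))%:E
      <= l%:E)%E.
  move=> as_ sb; apply: le_trans (ltW lenl).
  apply: le_ge0_integral => x; rewrite ?lee_fin//=.
  by rewrite !in_itv/= => /andP[-> /lt_le_trans ->].
have hu s j : a <= s -> s <= b -> `|(c s).1.1 ord0 j - (c a).1.1 ord0 j| <= l.
  move=> as_ sb; rewrite -lee_fin; apply: le_trans (sub s as_ sb).
  apply: (@functional_increment_le _ _ a s c (fun q : heis R n => q.1.1 ord0 j)) => //.
  - exact: horizontal_curve_init hc.
  - exact: bounded_functional_x.
  - by move=> r _ _ _; exact: (coord_le_heis_norm _ j).1.
have hv s j : a <= s -> s <= b -> `|(c s).1.2 ord0 j - (c a).1.2 ord0 j| <= l.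
  move=> as_ sb; rewrite -lee_fin; apply: le_trans (sub s as_ sb).
  apply: (@functional_increment_le _ _ a s c (fun q : heis R n => q.1.2 ord0 j)) => //.
  - exact: horizontal_curve_init hc.
  - exact: bounded_functional_y.
  - by move=> r _ _ _; exact: (coord_le_heis_norm _ j).2.
split; [by move=> j; apply: hu => //; exact: ltW|by move=> j; apply: hv => //; exact: ltW|].
pose T (q : heis R n) := q.2 - 2 * \sum_j ((c a).1.2 ord0 j * q.1.1 ord0 j - (c a).1.1 ord0 j * q.1.2 ord0 j).
(* The functional is divided by its bound [K] instead of multiplying the speed by it: the
   integral need not be homogeneous on functions that are not measurable. *)
pose K := 4 * n.+1%:R * l.
have K0 : 0 < K by rewrite !mulr_gt0.
have bT : bounded_functional (fun q => K^-1 * T q).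
  have [TB TZ [M M0 TM]] := bounded_functional_twist (c a); split.
  - by move=> x y; rewrite [T (x - y)]TB mulrBr.
  - by move=> k x; rewrite [T _]TZ mulrCA.
  - exists (K^-1 * M); first by rewrite mulr_gt0 ?invr_gt0.
    move=> x; rewrite normrM gtr0_norm ?invr_gt0// -mulrA.
    by apply: ler_wpM2l (TM x); rewrite ltW// invr_gt0.
have : `|K^-1 * T (c b) - K^-1 * T (c a)| <= l.
  rewrite -lee_fin; apply: le_trans (ltW lenl).
  apply: (functional_increment_le (ltW ab) hc bT) => // s /andP[as_ sb] _ [u [v E]].
  rewrite normrM gtr0_norm ?invr_gt0// ler_pdivrMl//.
  have uE : (derive1 c s).1.1 = u by rewrite E heis_frameE.
  have vE : (derive1 c s).1.2 = v by rewrite E heis_frameE.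
  rewrite [T _](_ : _ = 2 * \sum_j (((c s).1.2 ord0 j - (c a).1.2 ord0 j) * u ord0 j -
     ((c s).1.1 ord0 j - (c a).1.1 ord0 j) * v ord0 j)); last first.
    rewrite /T uE vE E heis_frameE /= -mulrBr -sumrB; congr (_ * _).
    by apply: eq_bigr => j _; ring.
  rewrite normrM ger0_norm// (_ : K = 2 * (2 * n.+1%:R * l)); last by rewrite /K; ring.
  rewrite -[leRHS]mulrA; apply: ler_wpM2l => //.
  apply: le_trans (ler_norm_sum _ _ _) _.
  apply: (@le_trans _ _ (\sum_(j < n) 2 * l * heis_norm (derive1 c s))).
    apply: ler_sum => j _; apply: le_trans (ler_normB _ _) _; rewrite !normrM.
    have [n1 n2] := coord_le_heis_norm (derive1 c s) j; rewrite uE vE in n1 n2.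
    have A1 := hu s j (ltW as_) (ltW sb). have A2 := hv s j (ltW as_) (ltW sb).
    rewrite mulrDl mul1r mulrDl.
    by apply: lerD; apply: ler_pM.
  rewrite sumr_const card_ord -[leLHS]mulr_natl mulrA; apply: ler_wpM2r => //.
  rewrite (_ : n%:R * (2 * l) = 2 * n%:R * l); last by ring.
  by apply: ler_wpM2r; [exact: ltW|apply: ler_wpM2l; rewrite ?ler_nat].
rewrite -mulrBr normrM gtr0_norm ?invr_gt0// ler_pdivrMl// => H.
rewrite (_ : heis_twist _ _ = T (c b) - T (c a)); last first.
  rewrite /heis_twist /T [X in _ = _ - (_ - _ * X)](_ : _ = 0); first ring.
  by apply: big1 => j _; rewrite mulrC subrr.
by rewrite expr2 mulrA.
Qed.

(** * Discrete area in a plane *)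

(** If the increment of [t] between nearby points is the elementary area
    2 (y dx - x dy) up to a quadratic error, then cutting a segment into
    [N.+1] equal pieces divides the total quadratic error by [N.+1], while the
    elementary areas add up exactly to that of the whole segment. *)
Lemma discrete_area_segment (R : realType) (t : R -> R -> R) (C e s : R)
    (N : nat) (x y x' y' : R) :
  0 <= x <= 1 -> 0 <= y <= 1 -> 0 <= x' <= 1 -> 0 <= y' <= 1 -> 0 <= C -> 0 < s ->
  (forall a b a' b', `|a| <= s -> `|b| <= s -> `|a'| <= s -> `|b'| <= s ->
     `|t a' b' - t a b - 2 * (b * a' - a * b')|
       <= C * (`|a' - a| + `|b' - b|) ^+ 2 + e * s ^+ 2) ->
  `|t (s * x') (s * y') - t (s * x) (s * y) - 2 * s ^+ 2 * (y * x' - x * y')|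
    <= (4 * C / N.+1%:R + N.+1%:R * e) * s ^+ 2.
Proof.
move=> /andP[x0 x1] /andP[y0 y1] /andP[x'0 x'1] /andP[y'0 y'1] C0 s0 H.
pose X r := s * (x + r * (x' - x)); pose Y r := s * (y + r * (y' - y)).
have XY r : 0 <= r <= 1 -> `|X r| <= s /\ `|Y r| <= s.
  move=> /andP[r0 r1].
  have K u u' : 0 <= u -> u <= 1 -> 0 <= u' -> u' <= 1 -> `|s * (u + r * (u' - u))| <= s.
    move=> u0 u1 u'0 u'1; rewrite normrM gtr0_norm// -[leRHS]mulr1 ler_wpM2l ?(ltW s0)//.
    by rewrite ler_norml; apply/andP; split; nra.
  by split; exact: K.
have N0 : 0 < N.+1%:R :> R by [].
pose r (k : nat) : R := k%:R / N.+1%:R.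
have r01 k : (k <= N.+1)%N -> 0 <= r k <= 1.
  by move=> kN; rewrite divr_ge0//= ler_pdivrMr// mul1r ler_nat.
have K k : (k <= N.+1)%N -> `|t (X (r k)) (Y (r k)) - t (X 0) (Y 0) -
     2 * s ^+ 2 * (r k * (y * x' - x * y'))|
    <= k%:R * (4 * C / N.+1%:R ^+ 2 + e) * s ^+ 2.
  elim: k => [_|k IH kN].
    by rewrite /r !mul0r mulr0 !subrr normr0.
  have rS : r k.+1 = r k + N.+1%:R^-1 by rewrite /r -addn1 natrD mulrDl mul1r.
  have := H (X (r k)) (Y (r k)) (X (r k.+1)) (Y (r k.+1)).
  have [XY1 XY2] := XY _ (r01 _ (ltnW kN)).
  have [XY3 XY4] := XY _ (r01 _ kN).
  move=> /(_ XY1 XY2 XY3 XY4).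
  have -> : X (r k.+1) - X (r k) = s * (x' - x) / N.+1%:R by rewrite rS /X; ring.
  have -> : Y (r k.+1) - Y (r k) = s * (y' - y) / N.+1%:R by rewrite rS /Y; ring.
  have -> : Y (r k) * X (r k.+1) - X (r k) * Y (r k.+1) =
      s ^+ 2 * (N.+1%:R^-1 * (y * x' - x * y')).
    by rewrite rS /X /Y; ring.
  have small u u' : 0 <= u -> u <= 1 -> 0 <= u' -> u' <= 1 ->
      `|s * (u' - u) / N.+1%:R| <= s / N.+1%:R.
    move=> u0 u1 u'0 u'1; rewrite !normrM (gtr0_norm s0) (@gtr0_norm _ N.+1%:R^-1) ?invr_gt0//.
    rewrite ler_wpM2r ?invr_ge0// -[leRHS]mulr1 ler_wpM2l ?(ltW s0)//.
    by rewrite ler_norml; apply/andP; split; lra.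
  have sq : (`|s * (x' - x) / N.+1%:R| + `|s * (y' - y) / N.+1%:R|) ^+ 2
       <= 4 / N.+1%:R ^+ 2 * s ^+ 2.
    rewrite (_ : 4 / _ * _ = (s / N.+1%:R + s / N.+1%:R) ^+ 2); last first.
      by rewrite -exprVn; ring.
    by rewrite lerXn2r ?nnegrE ?addr_ge0 ?divr_ge0 ?(ltW s0)// lerD// small.
  move=> Hk; have {}IH := IH (ltnW kN).
  have := ler_wpM2l C0 sq.
  have -> : k.+1%:R = k%:R + 1 :> R by rewrite -natr1.
  move=> H2; move: IH Hk; set P := (X in `|X| <= _ -> _); move=> IH.
  set Q := (X in `|X| <= _ -> _); move=> Hk.
  rewrite (_ : _ - _ = P + Q); last by rewrite /P /Q rS; ring.
  apply: le_trans (ler_normD _ _) _; apply: le_trans (lerD IH Hk) _.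
  rewrite [leRHS](_ : _ = k%:R * (4 * C / N.+1%:R ^+ 2 + e) * s ^+ 2 +
    (C * (4 / N.+1%:R ^+ 2 * s ^+ 2) + e * s ^+ 2)); last by ring.
  by rewrite lerD2l lerD2r.
have := K N.+1 (leqnn _).
have -> : r N.+1 = 1 by rewrite /r divff// gt_eqF.
have -> : X 1 = s * x' by rewrite /X; ring.
have -> : Y 1 = s * y' by rewrite /Y; ring.
have -> : X 0 = s * x by rewrite /X; ring.
have -> : Y 0 = s * y by rewrite /Y; ring.
rewrite mul1r => /le_trans; apply; rewrite le_eqVlt; apply/orP; left; apply/eqP.
by field; rewrite gt_eqF.
Qed.

(** The form 2 (y dx - x dy) is not closed, so that it has no primitive even in
    this coarse sense.  The increments of [t] along the triangle with vertices
    (0, 0), (1, 0), (0, 1), scaled by [s], sum to zero, whereas its side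
    from (1, 0) to (0, 1) carries area of order [s ^+ 2]. *)
Lemma no_area_potential (R : realType) (t : R -> R -> R) (C K : R) :
  (forall e : R, 0 < e -> exists2 d : R, 0 < d & forall s : R, 0 < s -> s < d ->
   forall a b a' b', `|a| <= s -> `|b| <= s -> `|a'| <= s -> `|b'| <= s ->
     `|t a' b' - t a b - 2 * (b * a' - a * b')|
       <= C * (`|a' - a| + `|b' - b|) ^+ 2 + K * e * s ^+ 2) -> False.
Proof.
move=> H.
pose C' := `|C|; have C'0 : 0 <= C' by exact: normr_ge0.
(* Each of the three sides may contribute an error of at most [s ^+ 2 / 3]; the area term is
   [2 * s ^+ 2]. *)
pose N := Num.trunc (24 * C').
have N0 : 0 < N.+1%:R :> R by [].
have HN : 24 * C' <= N.+1%:R by apply/ltW; rewrite truncnS_gt.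
pose e := (6 * N.+1%:R * (`|K| + 1))^-1.
have K1 : 0 < `|K| + 1 by rewrite ltr_wpDl.
have e0 : 0 < e by rewrite invr_gt0 !mulr_gt0.
have [d d0 Hd] := H _ e0.
pose s := d / 2.
have s0 : 0 < s by rewrite divr_gt0.
have sd : s < d by rewrite /s; lra.
have H' a b a' b' : `|a| <= s -> `|b| <= s -> `|a'| <= s -> `|b'| <= s ->
     `|t a' b' - t a b - 2 * (b * a' - a * b')|
       <= C' * (`|a' - a| + `|b' - b|) ^+ 2 + (K * e) * s ^+ 2.
  move=> h1 h2 h3 h4; apply: le_trans (Hd s s0 sd _ _ _ _ h1 h2 h3 h4) _.
  by rewrite lerD2r ler_wpM2r ?sqr_ge0// ler_norm.
have Z : 0 <= (0 : R) <= 1 by rewrite lexx ler01.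
have U : 0 <= (1 : R) <= 1 by rewrite lexx ler01.
have S1 := discrete_area_segment N Z Z U Z C'0 s0 H'.
have S2 := discrete_area_segment N U Z Z U C'0 s0 H'.
have S3 := discrete_area_segment N Z U Z Z C'0 s0 H'.
have B : 4 * C' / N.+1%:R + N.+1%:R * (K * e) <= 1 / 3.
  have B1 : 4 * C' / N.+1%:R <= 1 / 6 by rewrite ler_pdivrMr//; lra.
  have B2 : N.+1%:R * (K * e) <= 1 / 6.
    rewrite /e (_ : N.+1%:R * _ = (K / (`|K| + 1)) / 6); last first.
      by field; rewrite ?gt_eqF.
    by rewrite ler_wpM2r// ler_pdivrMr// mul1r (le_trans (ler_norm K))// lerDl.
  by apply: le_trans (lerD B1 B2) _; lra.
have s20 : 0 < s ^+ 2 by rewrite exprn_gt0.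
have {}B := ler_wpM2r (ltW s20) B.
move: S1 S2 S3; rewrite !mulr0 !mulr1.
move=> /le_trans/(_ B) S1 /le_trans/(_ B) S2 /le_trans/(_ B) S3.
move: S1 S2 S3; rewrite !ler_norml => /andP[? ?] /andP[? ?] /andP[? ?].
lra.
Qed.

(** [dU] and [dV] stand for the increments of the [x] and [y] coordinates of a
    contact map on a plane of directions, and [t] for the twist from the centre.
    Since dU = a U0 to first order, the pairing dV . dU' only sees
    U0 . dV = b, which turns the contact condition into a primitive of the area
    form, excluded by [no_area_potential]. *)
Lemma no_transverse_plane (R : realType) (n : nat) (U0 : 'I_n -> R)
    (dU dV : R -> R -> 'I_n -> R) (t : R -> R -> R) (L : R) : 0 <= L ->
  (forall e : R, 0 < e -> exists2 d : R, 0 < d & forall s a b : R, s < d ->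
     `|a| <= s -> `|b| <= s ->
     [/\ forall j, `|dU a b j - a * U0 j| <= e * s,
         `|\sum_j U0 j * dV a b j - b| <= e * s &
         forall j, `|dV a b j| <= L * s]) ->
  (exists2 d : R, 0 < d & forall s a b a' b' : R, s < d ->
     `|a| <= s -> `|b| <= s -> `|a'| <= s -> `|b'| <= s ->
     `|t a' b' - t a b - 2 * \sum_j (dV a b j * dU a' b' j - dU a b j * dV a' b' j)|
       <= L * (`|a' - a| + `|b' - b|) ^+ 2) -> False.
Proof.
move=> L0 H1 [d2 d20 H2].
apply: (@no_area_potential _ t L (4 * (n%:R * L + 1))) => e e0.
have [d d0 Hd] := H1 _ e0.
exists (Num.min d d2) => [|s s0]; first by rewrite lt_min d0.
rewrite lt_min => /andP[sd sd2] a b a' b' as_ bs a's b's.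
have [u1 v1 w1] := Hd _ _ _ sd as_ bs.
have [u2 v2 w2] := Hd _ _ _ sd a's b's.
have key (p q : 'I_n -> R) (al ka : R) :
    (forall j, `|p j - al * U0 j| <= e * s) -> `|al| <= s ->
    `|\sum_j U0 j * q j - ka| <= e * s -> (forall j, `|q j| <= L * s) ->
    `|\sum_j q j * p j - ka * al| <= (n%:R * L + 1) * e * s ^+ 2.
  move=> h1 h2 h3 h4.
  have -> : \sum_j q j * p j - ka * al =
      \sum_j q j * (p j - al * U0 j) + al * (\sum_j U0 j * q j - ka).
    rewrite mulrBr mulr_sumr addrA -big_split/= (mulrC al ka); congr (_ - _).
    by apply: eq_bigr => j _; ring.
  apply: le_trans (ler_normD _ _) _.
  rewrite (_ : _ * _ * _ = n%:R * (L * s * (e * s)) + s * (e * s)); last by ring.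
  apply: lerD; last by rewrite normrM ler_pM.
  apply: le_trans (ler_norm_sum _ _ _) _.
  apply: (@le_trans _ _ (\sum_(j < n) L * s * (e * s))).
    by apply: ler_sum => j _; rewrite normrM ler_pM.
  by rewrite sumr_const card_ord mulr_natl.
have k1 := key _ _ _ _ u2 a's v1 w1.
have k2 := key _ _ _ _ u1 as_ v2 w2.
have h := H2 s a b a' b' sd2 as_ bs a's b's.
have E : \sum_j (dV a b j * dU a' b' j - dU a b j * dV a' b' j) =
   \sum_j (dV a b j * dU a' b' j) - \sum_j (dV a' b' j * dU a b j).
  by rewrite -sumrB; apply: eq_bigr => j _; ring.
rewrite E in h; move: h k1 k2; set A := \sum_j _; set B := \sum_j _.
rewrite !ler_norml => /andP[h1 h2] /andP[h3 h4] /andP[h5 h6].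
by apply/andP; split; lra.
Qed.

(** * The rank of projected contact maps *)

(** On the Legendrian sphere the vertical coordinate is - 2 (a - a^3 / 3) and
    x . y is a (1 - a^2); this is the linear combination of them that
    returns a. *)
Definition heis_height (R : realType) (n : nat) (p : heis R n) : R :=
  - (3 / 4 * p.2 + 1 / 2 * \sum_j p.1.1 ord0 j * p.1.2 ord0 j).

Definition heis_proj (R : realType) (n : nat) (p : heis R n) : 'rV[R]_n.+1 :=
  \row_i (if unlift ord0 i is Some j then p.1.1 ord0 j else heis_height p).

(** Left invariance: seen from [o], the twist between [p] and [q] is the
    difference of the twists from [o], corrected by the symplectic form of the
    horizontal displacements. *)
Lemma heis_twist_cocycle (R : realType) (n : nat) (o p q : heis R n) :
  heis_twist p q = heis_twist o q - heis_twist o p -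
    2 * \sum_j ((p.1.2 ord0 j - o.1.2 ord0 j) * (q.1.1 ord0 j - o.1.1 ord0 j) -
                (p.1.1 ord0 j - o.1.1 ord0 j) * (q.1.2 ord0 j - o.1.2 ord0 j)).
Proof.
rewrite /heis_twist; set A := \sum_j _; set B := \sum_j _; set C := \sum_j _.
set D := \sum_j _; have -> : A = B - C + D.
  by rewrite /A /B /C /D -sumrB -big_split; apply: eq_bigr => j _ /=; ring.
ring.
Qed.

(** The twist and the last sum are of second order along contact maps, so that
    the differential of the height involves only the horizontal coordinates. *)
Lemma heis_height_increment (R : realType) (n : nat) (p q : heis R n) :
  heis_height q - heis_height p =
   - (3 / 4) * heis_twist p q
   - 2 * (\sum_j p.1.2 ord0 j * (q.1.1 ord0 j - p.1.1 ord0 j))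
   + \sum_j p.1.1 ord0 j * (q.1.2 ord0 j - p.1.2 ord0 j)
   - 1 / 2 * \sum_j (q.1.1 ord0 j - p.1.1 ord0 j) * (q.1.2 ord0 j - p.1.2 ord0 j).
Proof.
rewrite /heis_twist /heis_height.
set A := \sum_j q.1.1 _ _ * _; set B := \sum_j p.1.1 _ _ * p.1.2 _ _.
set C := \sum_j (_ - _); set D := \sum_j p.1.2 _ _ * (_ - _).
set E := \sum_j p.1.1 _ _ * (_ - _); set G := \sum_j (_ - _) * _.
have CDE : C = D - E by rewrite /C /D /E -sumrB; apply: eq_bigr => j _; ring.
have AB : A = B + D + E + G.
  by rewrite /A /B /D /E /G -!big_split; apply: eq_bigr => j _ /=; ring.
rewrite AB CDE; lra.
Qed.

Lemma differentiable_approx (R : realType) (V W : normedModType R) (f : V -> W)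
    (x : V) : differentiable f x -> forall e : R, 0 < e ->
  exists2 d : R, 0 < d & forall h, `|h| < d ->
    `|f (h + x) - f x - 'd f x h| <= e * `|h|.
Proof.
move=> /diff_locally/eqaddoP fx e e0.
have /nbhs_ballP[d /= d0 Hd] := fx _ e0.
exists d => // h hd; have := Hd h; rewrite -ball_normE /ball_/= sub0r normrN.
by move=> /(_ hd); rewrite !fctE/= opprD addrA.
Qed.

(** Full rank gives directions [a] and [k] with the following images: along
    [a], the [x] part moves by U0 and the first-order part of U0 . dy vanishes;
    along [k], the [x] part is stationary and U0 . dy moves at unit speed.
    This is the configuration excluded by [no_transverse_plane].  Only
    differentiability of the projection is used: the [y] part of [G] is merely
    Lipschitz, and just its component along U0 is controlled, through
    [heis_height_increment]. *)
Lemma rank_jacobian_heis_proj (R : realType) (d n : nat) (G : 'rV[R]_d -> heis R n)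
    (F : 'rV[R]_d -> 'rV[R]_n.+1) (x : 'rV[R]_d) (r L : R) : 0 < r -> 0 <= L ->
  (forall y z, `|y - x| < r -> `|z - x| < r ->
     [/\ forall j, `|(G z).1.1 ord0 j - (G y).1.1 ord0 j| <= L * `|z - y|,
         forall j, `|(G z).1.2 ord0 j - (G y).1.2 ord0 j| <= L * `|z - y| &
         `|heis_twist (G y) (G z)| <= L * `|z - y| ^+ 2]) ->
  (forall y, `|y - x| < r -> F y = heis_proj (G y)) ->
  differentiable F x -> \rank ('J F x) <> n.+1.
Proof.
move=> r0 L0 HG HF dF rk.
set J := 'J F x in rk.
have full w : exists h : 'rV_d, h *m J = w.
  have : (w <= J)%MS by apply: submx_full; rewrite /row_full rk.
  by case/submxP => h ->; exists h.
pose U0 j := (G x).1.1 ord0 j; pose V0 j := (G x).1.2 ord0 j.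
(* The first entry is the variation of the height for which U0 . dy vanishes. *)
pose wa : 'rV[R]_n.+1 :=
  \row_i (if unlift ord0 i is Some j then U0 j else - 2 * \sum_j V0 j * U0 j).
have [a aJ] := full wa.
have [k kJ] := full (delta_mx ord0 ord0).
pose P s t := s *: a + t *: k.
pose M := `|a| + `|k|.
have M0 : 0 <= M by rewrite addr_ge0.
have PM s t sg : `|s| <= sg -> `|t| <= sg -> `|P s t| <= M * sg.
  move=> ss ts; apply: le_trans (ler_normD _ _) _; rewrite !normrZ /M mulrDl.
  by rewrite lerD// mulrC ler_wpM2l.
have PB s t s' t' : `|P s' t' - P s t| <= M * (`|s' - s| + `|t' - t|).
  rewrite (_ : P s' t' - P s t = P (s' - s) (t' - t)).
    by apply: PM; rewrite ?lerDl ?lerDr.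
  by rewrite /P !scalerBl opprD addrACA.
pose dU s t j := (G (P s t + x)).1.1 ord0 j - U0 j.
pose dV s t j := (G (P s t + x)).1.2 ord0 j - V0 j.
pose tau s t := heis_twist (G x) (G (P s t + x)).
have nearx s t sg : sg < r / (M + 1) -> `|s| <= sg -> `|t| <= sg -> `|P s t + x - x| < r.
  move=> sgr ss ts; rewrite addrK; apply: le_lt_trans (PM _ _ _ ss ts) _.
  have sg0 : 0 <= sg by apply: le_trans ss.
  rewrite ltr_pdivlMr in sgr; last by rewrite ltr_wpDl.
  by apply: le_lt_trans sgr; rewrite mulrDr mulr1 mulrC lerDl.
pose L' := L * (M + 1) ^+ 2.
have M1 : 0 < M + 1 by rewrite ltr_wpDl.
have LL' : L * M <= L'.
  rewrite /L' ler_wpM2l//; nra.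
apply: (@no_transverse_plane _ _ U0 dU dV tau L').
- by rewrite mulr_ge0// sqr_ge0.
- move=> e e0.
  pose S := \sum_j `|V0 j|.
  have S0 : 0 <= S by exact: sumr_ge0.
  pose K := M * (1 + 2 * S) + 3 / 4 * L * M ^+ 2 + 1 / 2 * (n%:R * (L * M) ^+ 2).
  have K0 : 0 <= K by rewrite !addr_ge0// !mulr_ge0// ?exprn_ge0// ?addr_ge0// mulr_ge0.
  have K1 : 0 < K + M + 1 by rewrite ltr_wpDl// addr_ge0.
  pose e1 := e / (K + M + 1).
  have e10 : 0 < e1 by rewrite divr_gt0.
  have e1K : K * e1 <= e.
    by rewrite /e1 mulrCA ger_pMr// ler_pdivrMr// mul1r; lra.
  have e1M : M * e1 <= e.
    by rewrite /e1 mulrCA ger_pMr// ler_pdivrMr// mul1r; lra.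
  have [d0 d00 Hd] := differentiable_approx dF e10.
  pose dd := Num.min (Num.min (r / (M + 1)) (d0 / (M + 1))) e1.
  exists dd; first by rewrite !lt_min e10 !divr_gt0.
  move=> sg s t; rewrite !lt_min => /andP[/andP[sgr sgd] sge] ss ts.
  have sg0 : 0 <= sg by apply: le_trans ss.
  have Pr := nearx _ _ _ sgr ss ts.
  have Pd : `|P s t| < d0.
    apply: le_lt_trans (PM _ _ _ ss ts) _.
    rewrite ltr_pdivlMr// in sgd; apply: le_lt_trans sgd.
    by rewrite mulrDr mulr1 mulrC lerDl.
  have xr : `|x - x| < r by rewrite subrr normr0.
  have [g1 g2 g3] := HG _ _ xr Pr; rewrite addrK in g1 g2 g3.
  have Dl : `|F (P s t + x) - F x - P s t *m J| <= e1 * (M * sg).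
    rewrite /J /jacobian mul_rV_lin1; apply: le_trans (Hd _ Pd) _.
    by rewrite ler_wpM2l ?(ltW e10)//; exact: PM.
  have PJ : P s t *m J = s *: wa + t *: delta_mx ord0 ord0.
    by rewrite mulmxDl -!scalemxAl aJ kJ.
  have FPx := HF _ Pr; have Fx := HF _ xr.
  have bU j : `|dU s t j - s * U0 j| <= e1 * (M * sg).
    apply: le_trans Dl; apply: le_trans (coord_le_mx_norm _ ord0 (lift ord0 j)).
    rewrite PJ FPx Fx !mxE liftK eqxx /=.
    by rewrite mulr0 addr0.
  have bW : `|heis_height (G (P s t + x)) - heis_height (G x) -
       (s * (- 2 * \sum_j V0 j * U0 j) + t)| <= e1 * (M * sg).
    apply: le_trans Dl; apply: le_trans (coord_le_mx_norm _ ord0 ord0).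
    by rewrite PJ FPx Fx !mxE unlift_none eqxx mulr1.
  have PMs := PM _ _ _ ss ts.
  have LMs : L * `|P s t| <= L * M * sg by rewrite -mulrA ler_wpM2l.
  split.
  - move=> j; apply: le_trans (bU j) _.
    by rewrite mulrA ler_wpM2r// mulrC.
  - rewrite (_ : _ - _ = (heis_height (G (P s t + x)) - heis_height (G x) -
       (s * (- 2 * \sum_j V0 j * U0 j) + t))
       + 2 * \sum_j V0 j * (dU s t j - s * U0 j)
       + 3 / 4 * tau s t
       + 1 / 2 * \sum_j dU s t j * dV s t j); last first.
      rewrite heis_height_increment -/(tau s t).
      rewrite [\sum_j V0 j * (dU s t j - _)](_ : _ =
        \sum_j V0 j * dU s t j - s * \sum_j V0 j * U0 j); last first.
        by rewrite mulr_sumr -sumrB; apply: eq_bigr => j _; ring.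
      by rewrite /dU /dV /U0 /V0; ring.
    have T1 : `|2 * \sum_j V0 j * (dU s t j - s * U0 j)| <= 2 * (S * (e1 * (M * sg))).
      rewrite normrM ger0_norm// ler_wpM2l//; apply: le_trans (ler_norm_sum _ _ _) _.
      by rewrite /S mulr_suml; apply: ler_sum => j _; rewrite normrM ler_wpM2l.
    have T2 : `|3 / 4 * tau s t| <= 3 / 4 * (L * (M * sg) ^+ 2).
      rewrite normrM ger0_norm// ler_wpM2l//; apply: le_trans g3 _.
      by rewrite ler_wpM2l// lerXn2r ?nnegrE// mulr_ge0.
    have T3 : `|1 / 2 * \sum_j dU s t j * dV s t j| <= 1 / 2 * (n%:R * (L * M * sg) ^+ 2).
      rewrite normrM ger0_norm// ler_wpM2l//; apply: le_trans (ler_norm_sum _ _ _) _.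
      apply: (@le_trans _ _ (\sum_(j < n) (L * M * sg) ^+ 2)).
        apply: ler_sum => j _; rewrite normrM expr2.
        by apply: ler_pM => //; [apply: le_trans (g1 j) _|apply: le_trans (g2 j) _].
      by rewrite sumr_const card_ord mulr_natl.
    have B1 := le_trans (ler_normD _ _) (lerD bW T1).
    have B2 := le_trans (ler_normD _ _) (lerD B1 T2).
    apply: le_trans (le_trans (ler_normD _ _) (lerD B2 T3)) _.
    apply: (@le_trans _ _ (K * e1 * sg)); last by rewrite ler_wpM2r.
    have X1 : L * (M * sg) ^+ 2 <= L * M ^+ 2 * (e1 * sg).
      rewrite exprMn [leLHS]mulrA; apply: ler_wpM2l.
        by rewrite mulr_ge0// exprn_ge0.
      by rewrite expr2 ler_wpM2r// ltW.
    have X2 : n%:R * (L * M * sg) ^+ 2 <= n%:R * (L * M) ^+ 2 * (e1 * sg).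
      rewrite exprMn [leLHS]mulrA; apply: ler_wpM2l.
        by rewrite mulr_ge0// exprn_ge0// mulr_ge0.
      by rewrite expr2 ler_wpM2r// ltW.
    rewrite /K; lra.
  - move=> j; apply: le_trans (g2 j) _; apply: le_trans LMs _.
    by rewrite ler_wpM2r.
- exists (r / (M + 1)); first by rewrite divr_gt0.
  move=> sg s t s' t' sgr ss ts s's t's.
  have Pr := nearx _ _ _ sgr ss ts.
  have P'r := nearx _ _ _ sgr s's t's.
  have [_ _] := HG _ _ Pr P'r.
  rewrite (heis_twist_cocycle (G x)) => H; apply: le_trans H _.
  rewrite opprD addrACA subrr addr0.
  apply: (@le_trans _ _ (L * (M * (`|s' - s| + `|t' - t|)) ^+ 2)).
    by rewrite ler_wpM2l// lerXn2r ?nnegrE// mulr_ge0// addr_ge0.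
  rewrite exprMn mulrA ler_wpM2r ?sqr_ge0// /L' ler_wpM2l//.
  by rewrite lerXn2r ?nnegrE ?(ltW M1)// lerDl.
Qed.

(** * The Euclidean norm and the cone over a null-homotopy *)

Lemma eucl_norm_ge0 (R : realType) (d : nat) (x : 'rV[R]_d) : 0 <= eucl_norm x.
Proof. exact: sqrtr_ge0. Qed.

Lemma eucl_normK (R : realType) (d : nat) (x : 'rV[R]_d) :
  eucl_norm x ^+ 2 = \sum_i x ord0 i ^+ 2.
Proof. by rewrite sqr_sqrtr// sumr_ge0// => i _; rewrite sqr_ge0. Qed.

Lemma coord_le_eucl_norm (R : realType) (d : nat) (x : 'rV[R]_d) i :
  `|x ord0 i| <= eucl_norm x.
Proof.
rewrite -sqrtr_sqr; apply: ler_wsqrtr; rewrite (bigD1 i)//= lerDl.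
by apply: sumr_ge0 => j _; rewrite sqr_ge0.
Qed.

Lemma eucl_norm_le_sum (R : realType) (d : nat) (x : 'rV[R]_d) :
  eucl_norm x <= \sum_i `|x ord0 i|.
Proof.
have S0 : 0 <= \sum_i `|x ord0 i| by exact: sumr_ge0.
rewrite -[leRHS](ger0_norm S0) -sqrtr_sqr; apply: ler_wsqrtr.
rewrite expr2 mulr_suml; apply: ler_sum => i _.
rewrite -real_normK ?num_real// expr2 ler_wpM2l// (bigD1 i)//= lerDl.
by apply: sumr_ge0.
Qed.

Lemma eucl_distC (R : realType) (d : nat) (x y : 'rV[R]_d) :
  eucl_dist x y = eucl_dist y x.
Proof.
rewrite /eucl_dist /eucl_norm; congr Num.sqrt.
by apply: eq_bigr => i _; rewrite !mxE -sqrrN opprB.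
Qed.

Lemma eucl_dist0 (R : realType) (d : nat) (x y : 'rV[R]_d) :
  (eucl_dist x y == 0) = (x == y).
Proof.
apply/idP/eqP => [/eqP xy|->].
  apply/rowP => i; apply/eqP; rewrite -subr_eq0 -normr_le0 -xy.
  by have := coord_le_eucl_norm (x - y) i; rewrite !mxE.
rewrite /eucl_dist /eucl_norm big1 ?sqrtr0// => i _.
by rewrite !mxE subrr expr0n.
Qed.

(** Divide |x|^2 - |y|^2 by |x| + |y| and estimate coordinatewise; the constant
    [d] is harmless and spares the Minkowski inequality. *)
Lemma eucl_norm_lipschitz (R : realType) (d : nat) (x y : 'rV[R]_d) :
  `|eucl_norm x - eucl_norm y| <= d%:R * eucl_dist x y.
Proof.
have [x0|x0] := eqVneq (eucl_norm x + eucl_norm y) 0.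
  have [-> ->] : eucl_norm x = 0 /\ eucl_norm y = 0.
    have := eucl_norm_ge0 x; have := eucl_norm_ge0 y; split; lra.
  by rewrite subrr normr0 mulr_ge0// eucl_norm_ge0.
have s0 : 0 < eucl_norm x + eucl_norm y.
  by rewrite lt_def x0 addr_ge0// eucl_norm_ge0.
rewrite -(ler_pM2r s0) -{1}(gtr0_norm s0) -normrM -subr_sqr !eucl_normK -sumrB.
apply: le_trans (ler_norm_sum _ _ _) _.
apply: (@le_trans _ _ (\sum_(i < d) eucl_dist x y * (eucl_norm x + eucl_norm y))).
  apply: ler_sum => i _; rewrite subr_sqr normrM ler_pM//.
    by have := coord_le_eucl_norm (x - y) i; rewrite !mxE.
  by apply: le_trans (ler_normD _ _) _; rewrite lerD// coord_le_eucl_norm.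
by rewrite sumr_const card_ord -[leLHS]mulr_natl mulrA.
Qed.

Lemma eucl_normZ (R : realType) (d : nat) (k : R) (x : 'rV[R]_d) :
  eucl_norm (k *: x) = `|k| * eucl_norm x.
Proof.
rewrite /eucl_norm -sqrtr_sqr -sqrtrM ?sqr_ge0//; congr Num.sqrt.
by rewrite mulr_sumr; apply: eq_bigr => i _; rewrite mxE exprMn.
Qed.

Lemma sphere_normalize (R : realType) (m : nat) (x : 'rV[R]_m.+1) :
  0 < eucl_norm x -> unit_sphere R m ((eucl_norm x)^-1 *: x).
Proof.
by move=> x0; rewrite /unit_sphere/= eucl_normZ gtr0_norm ?invr_gt0// mulVf// gt_eqF.
Qed.

Lemma unit_sphere_delta (R : realType) (m : nat) (i : 'I_m.+1) :
  unit_sphere R m (delta_mx ord0 i).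
Proof.
rewrite /unit_sphere/= /eucl_norm (bigD1 i)//= big1 => [|j ji].
  by rewrite !mxE !eqxx addr0 expr1n sqrtr1.
by rewrite !mxE (negbTE ji) expr0n.
Qed.

Lemma normalize_lipschitz (R : realType) (d : nat) (x y : 'rV[R]_d) :
  1 / 2 <= eucl_norm x -> 0 < eucl_norm y ->
  eucl_dist ((eucl_norm x)^-1 *: x) ((eucl_norm y)^-1 *: y) <=
  d%:R * (2 * (1 + d%:R)) * eucl_dist x y.
Proof.
move=> x12 y0; apply: le_trans (eucl_norm_le_sum _) _.
have x0 : 0 < eucl_norm x by apply: lt_le_trans x12; rewrite divr_gt0.
have xV : (eucl_norm x)^-1 <= 2.
  by rewrite -[leRHS]invrK lef_pV2 ?posrE ?invr_gt0//; move: x12; rewrite mul1r.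
have D0 : 0 <= eucl_dist x y by exact: eucl_norm_ge0.
apply: (@le_trans _ _ (\sum_(i < d) 2 * (1 + d%:R) * eucl_dist x y)).
  apply: ler_sum => i _; rewrite !mxE.
  rewrite (_ : _ - _ = (eucl_norm x)^-1 * ((x ord0 i - y ord0 i) +
    y ord0 i / eucl_norm y * (eucl_norm y - eucl_norm x))); last first.
    by field; rewrite !gt_eqF.
  rewrite normrM gtr0_norm ?invr_gt0// -[leRHS]mulrA ler_pM ?invr_ge0 ?(ltW x0)//.
  apply: le_trans (ler_normD _ _) _; rewrite mulrDl mul1r lerD//.
    by have := coord_le_eucl_norm (x - y) i; rewrite !mxE.
  rewrite normrM -[leRHS]mul1r ler_pM//; last by rewrite distrC eucl_norm_lipschitz.
  rewrite normrM (@gtr0_norm _ (eucl_norm y)^-1) ?invr_gt0// ler_pdivrMr// mul1r.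
  exact: coord_le_eucl_norm.
by rewrite sumr_const card_ord -[leLHS]mulr_natl mulrA.
Qed.

Lemma cyl_dist_le (R : realType) (m : nat) (u v : 'rV[R]_m.+1 * R) :
  cyl_dist u v <= eucl_dist u.1 v.1 + `|u.2 - v.2|.
Proof.
have D0 : 0 <= eucl_dist u.1 v.1 by exact: eucl_norm_ge0.
have S0 : 0 <= eucl_dist u.1 v.1 + `|u.2 - v.2| by rewrite addr_ge0.
rewrite -[leRHS](ger0_norm S0) -sqrtr_sqr; apply: ler_wsqrtr.
rewrite -(real_normK (num_real (u.2 - v.2))).
have := mulr_ge0 D0 (normr_ge0 (u.2 - v.2)); nra.
Qed.

Lemma cyl_dist_eucl (R : realType) (m : nat) (x y : 'rV[R]_m.+1) (s t : R) :
  eucl_dist x y <= cyl_dist (x, s) (y, t).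
Proof.
rewrite /cyl_dist/= -[leLHS]ger0_norm ?eucl_norm_ge0// -sqrtr_sqr.
by apply: ler_wsqrtr; rewrite lerDl sqr_ge0.
Qed.

(** The homotopy is spread over the annulus 1/2 <= |x| <= 1, the inner ball being
    sent to the base point.  Polar coordinates are Lipschitz on the annulus,
    while on the whole ball they are not near the origin. *)
Lemma cone_of_null_homotopy (R : realType) (X : Type) (dX : X -> X -> \bar R)
    (m : nat) (x0 : X) (f : 'rV[R]_m.+1 -> X) :
  based_lip_homotopic dX x0 (fun=> x0) f ->
  exists G : 'rV[R]_m.+1 -> X,
    lipschitz_wrt (@eucl_dist R m.+1) dX (unit_ball R m) G /\
    forall x, unit_sphere R m x -> G x = f x.
Proof.
move=> [H [[L HL] H0 H1 Hb]].
(* The time in the homotopy, rescaled so that the annulus has times in [0, 1]. *)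
pose r (x : 'rV[R]_m.+1) := 2 * eucl_norm x - 1.
pose nx (x : 'rV[R]_m.+1) := (eucl_norm x)^-1 *: x.
pose G x := if 1 / 2 <= eucl_norm x then H (nx x, r x) else x0.
exists G; split; last first.
  move=> x; rewrite /unit_sphere/= => x1.
  rewrite /G x1 (_ : 1 / 2 <= 1) /nx /r ?x1 ?invr1 ?scale1r; last lra.
  by rewrite (_ : 2 * 1 - 1 = 1) ?H1//; ring.
pose D : R := m.+1%:R.
pose K := `|L| * (D * (2 * (1 + D)) + 2 * D).
have D0 : 0 <= D by [].
have HL' u v (k : R) : unit_sphere R m u.1 -> unit_sphere R m v.1 ->
    0 <= u.2 <= 1 -> 0 <= v.2 <= 1 -> cyl_dist u v <= (D * (2 * (1 + D)) + 2 * D) * k ->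
    (dX (H u) (H v) <= (K * k)%:E)%E.
  move=> u1 v1 u2 v2 uvk; apply: le_trans (HL u v _ _) _.
  - by split => //=; rewrite in_itv.
  - by split => //=; rewrite in_itv.
  - rewrite lee_fin /K -mulrA; apply: le_trans (ler_wpM2r (sqrtr_ge0 _) (ler_norm L)) _.
    by rewrite ler_wpM2l.
have rr x y : `|r x - r y| <= 2 * D * eucl_dist x y.
  rewrite /r (_ : _ - _ = 2 * (eucl_norm x - eucl_norm y)); last by ring.
  by rewrite normrM ger0_norm// -mulrA ler_wpM2l// eucl_norm_lipschitz.
have DD0 : 0 <= D * (2 * (1 + D)) by rewrite !mulr_ge0 ?addr_ge0.
have nS x : 1 / 2 <= eucl_norm x -> unit_sphere R m (nx x).
  by move=> x12; apply: sphere_normalize; apply: lt_le_trans x12; rewrite divr_gt0.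
have r01 x : 1 / 2 <= eucl_norm x -> unit_ball R m x -> 0 <= r x <= 1.
  by rewrite /unit_ball/= /r => ? ?; apply/andP; split; lra.
have Z01 : 0 <= (0 : R) <= 1 by rewrite lexx ler01.
exists K => x y Bx By; have E0 : 0 <= eucl_dist x y by exact: eucl_norm_ge0.
have half u v (k : 'rV[R]_m.+1) : 1 / 2 <= eucl_norm u -> unit_ball R m u ->
    eucl_norm v < 1 / 2 -> `|r u| <= 2 * D * eucl_dist u v.
  move=> u12 Bu v12; apply: le_trans (rr u v).
  have /andP[ru _] := r01 _ u12 Bu; rewrite ger0_norm//.
  by apply: le_trans (ler_norm _); rewrite /r; lra.
have dii z : eucl_dist z z = 0 by apply/eqP; rewrite eucl_dist0.
rewrite /G; have [x12|x12] := leP (1 / 2) (eucl_norm x);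
  have [y12|y12] := leP (1 / 2) (eucl_norm y).
- apply: HL'; rewrite ?r01//=; [exact: nS|exact: nS|].
  apply: le_trans (cyl_dist_le _ _) _; rewrite mulrDl lerD//=.
  by apply: normalize_lipschitz => //; apply: lt_le_trans y12; rewrite divr_gt0.
- rewrite -(H0 _ (nS x x12)); apply: HL'; rewrite ?r01//=; [exact: nS|exact: nS|].
  apply: le_trans (cyl_dist_le _ _) _; rewrite /= subr0 dii mulrDl lerD//.
    by rewrite mulr_ge0.
  exact: half.
- rewrite -(H0 _ (nS y y12)); apply: HL'; rewrite ?r01//=; [exact: nS|exact: nS|].
  apply: le_trans (cyl_dist_le _ _) _; rewrite /= sub0r normrN dii mulrDl lerD//.
    by rewrite mulr_ge0.
  by rewrite eucl_distC; exact: half.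
- have Sb : unit_sphere R m (sphere_base R m) by exact: unit_sphere_delta.
  rewrite -(H0 _ Sb); apply: HL' => //=.
  apply: le_trans (cyl_dist_le _ _) _; rewrite /= subrr normr0 dii addr0.
  by rewrite mulr_ge0// addr_ge0// mulr_ge0.
Qed.

(** * Translations and contact Lipschitz maps of the ball *)

Definition heis_mul (R : realType) (n : nat) (g p : heis R n) : heis R n :=
  (g.1.1 + p.1.1, g.1.2 + p.1.2, g.2 + p.2 +
   2 * \sum_j (g.1.2 ord0 j * p.1.1 ord0 j - g.1.1 ord0 j * p.1.2 ord0 j)).

Definition heis_inv (R : realType) (n : nat) (g : heis R n) : heis R n :=
  (- g.1.1, - g.1.2, - g.2).

Lemma heis_mulKV (R : realType) (n : nat) (g p : heis R n) :
  heis_mul (heis_inv g) (heis_mul g p) = p.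
Proof.
case: p => [[u v] t]; rewrite /heis_mul /heis_inv /= !addKr; congr (_, _, _).
rewrite [X in _ + 2 * X](_ : _ = - \sum_j
   (g.1.2 ord0 j * u ord0 j - g.1.1 ord0 j * v ord0 j)); first by ring.
by rewrite -sumrN; apply: eq_bigr => j _; rewrite !mxE; ring.
Qed.

Lemma heis_mulK (R : realType) (n : nat) (g p : heis R n) :
  heis_mul (heis_mul g (heis_inv p)) p = g.
Proof.
case: g => [[u v] t]; rewrite /heis_mul /heis_inv /= !subrK; congr (_, _, _).
set A := \sum_j _; set B := \sum_j _; have -> : B = - A; last by ring.
by rewrite /A /B -sumrN; apply: eq_bigr => j _; rewrite !mxE; ring.
Qed.

Lemma heis_twist_mul (R : realType) (n : nat) (g p q : heis R n) :
  heis_twist (heis_mul g p) (heis_mul g q) = heis_twist p q.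
Proof.
rewrite /heis_twist /heis_mul /=.
set A := \sum_j _; set B := \sum_j _; set C := \sum_j _; set D := \sum_j _.
have -> : C = A - B + D; last by ring.
by rewrite /A /B /C /D -sumrB -big_split; apply: eq_bigr => j _ /=; rewrite !mxE; ring.
Qed.

(** What remains of the Lipschitz condition for the Carnot-Caratheodory distance:
    first-order bounds on the horizontal coordinates, second-order bound on the
    twist.  Unlike the distance itself, these quantities are visibly invariant
    under left translations. *)
Definition contact_lipschitz (R : realType) (d n : nat) (A : set 'rV[R]_d)
    (G : 'rV[R]_d -> heis R n) : Prop :=
  exists2 L : R, 0 <= L & forall y z, A y -> A z ->
     [/\ forall j, `|(G z).1.1 ord0 j - (G y).1.1 ord0 j| <= L * eucl_dist z y,
         forall j, `|(G z).1.2 ord0 j - (G y).1.2 ord0 j| <= L * eucl_dist z y &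
         `|heis_twist (G y) (G z)| <= L * eucl_dist z y ^+ 2].

Lemma heis_twistxx (R : realType) (n : nat) (p : heis R n) : heis_twist p p = 0.
Proof.
rewrite /heis_twist subrr big1 ?mulr0 ?subr0// => j _.
by rewrite mulrC subrr.
Qed.

Lemma contact_lipschitz_dcc (R : realType) (d n : nat) (A : set 'rV[R]_d)
    (G : 'rV[R]_d -> heis R n) :
  lipschitz_wrt (@eucl_dist R d) (@dcc R n) A G -> contact_lipschitz A G.
Proof.
move=> [L HL]; pose K := `|L| + 1.
have K1 : 1 <= K by rewrite /K lerDr.
have K0 : 0 <= K by apply: le_trans K1.
pose M := 4 * n.+1%:R * K ^+ 2.
have M0 : 0 <= M by rewrite mulr_ge0// exprn_ge0.
exists (K + M); first by rewrite addr_ge0.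
move=> y z Ay Az; have [->|zy] := eqVneq z y.
  by split=> [j|j|]; rewrite ?heis_twistxx ?subrr ?normr0 mulr_ge0 ?addr_ge0// ?exprn_ge0 ?eucl_norm_ge0.
have D0 : 0 < eucl_dist z y by rewrite lt_def eucl_dist0 zy eucl_norm_ge0.
have lt : (dcc (G y) (G z) < (K * eucl_dist z y)%:E)%E.
  apply: le_lt_trans (HL _ _ Ay Az) _; rewrite lte_fin eucl_distC ltr_pM2r//.
  by rewrite (le_lt_trans (ler_norm _))// ltrDl.
have [h1 h2 h3] := dcc_lt_bounds lt.
split=> [j|j|].
- by apply: le_trans (h1 j) _; rewrite ler_wpM2r ?(ltW D0)// lerDl.
- by apply: le_trans (h2 j) _; rewrite ler_wpM2r ?(ltW D0)// lerDl.
- by apply: le_trans h3 _; rewrite exprMn mulrA ler_wpM2r ?sqr_ge0// lerDr.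
Qed.

Lemma contact_lipschitz_mul (R : realType) (d n : nat) (A : set 'rV[R]_d)
    (g : heis R n) (G : 'rV[R]_d -> heis R n) :
  contact_lipschitz A G -> contact_lipschitz A (heis_mul g \o G).
Proof.
move=> [L L0 HL]; exists L => // y z Ay Az; have [h1 h2 h3] := HL y z Ay Az.
split=> [j|j|]; last by rewrite /= heis_twist_mul.
  by rewrite /= !mxE opprD addrACA subrr add0r.
by rewrite /= !mxE opprD addrACA subrr add0r.
Qed.

Lemma eucl_dist_ball_le (R : realType) (m : nat) (x y : 'rV[R]_m.+1) :
  unit_ball R m x -> unit_ball R m y -> eucl_dist x y <= m.+1%:R * 2.
Proof.
rewrite /unit_ball/= => Bx By; apply: le_trans (eucl_norm_le_sum _) _.
apply: (@le_trans _ _ (\sum_(i < m.+1) 2)).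
  apply: ler_sum => i _; rewrite !mxE; apply: le_trans (ler_normB _ _) _.
  have := coord_le_eucl_norm x i; have := coord_le_eucl_norm y i; lra.
by rewrite sumr_const card_ord -[leLHS]mulr_natl.
Qed.

(** The bounds on horizontal coordinates make the sums in [heis_height_increment]
    Lipschitz, because a contact Lipschitz map is bounded on the ball; the twist
    is quadratic, hence Lipschitz on a bounded set. *)
Lemma heis_proj_lipschitz (R : realType) (m n : nat)
    (G : 'rV[R]_m.+1 -> heis R n) : contact_lipschitz (unit_ball R m) G ->
  lipschitz_wrt (@eucl_dist R m.+1) (fun y z => (eucl_dist y z)%:E)
    (unit_ball R m) (@heis_proj R n \o G).
Proof.
move=> [L L0 HL].
pose D : R := m.+1%:R * 2.
have D0 : 0 <= D by rewrite mulr_ge0.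
pose o : 'rV[R]_m.+1 := 0.
have Bo : unit_ball R m o.
  by rewrite /unit_ball/= /eucl_norm big1 ?sqrtr0// => i _; rewrite mxE expr0n.
pose C := \sum_j (`|(G o).1.1 ord0 j| + `|(G o).1.2 ord0 j|) + L * D.
have C0 : 0 <= C by rewrite addr_ge0 ?mulr_ge0// sumr_ge0// => j _; rewrite addr_ge0.
have bnd z j : unit_ball R m z -> `|(G z).1.1 ord0 j| <= C /\ `|(G z).1.2 ord0 j| <= C.
  move=> Bz; have [h1 h2 _] := HL o z Bo Bz.
  have zo : L * eucl_dist z o <= L * D by rewrite ler_wpM2l// eucl_dist_ball_le.
  have S : `|(G o).1.1 ord0 j| + `|(G o).1.2 ord0 j| <=
      \sum_j (`|(G o).1.1 ord0 j| + `|(G o).1.2 ord0 j|).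
    by rewrite (bigD1 j)//= lerDl sumr_ge0// => i _; rewrite addr_ge0.
  have N1 := normr_ge0 ((G o).1.1 ord0 j); have N2 := normr_ge0 ((G o).1.2 ord0 j).
  split; rewrite /C.
    rewrite -[(G z).1.1 ord0 j](subrK ((G o).1.1 ord0 j)).
    by apply: le_trans (ler_normD _ _) _; have := h1 j; lra.
  rewrite -[(G z).1.2 ord0 j](subrK ((G o).1.2 ord0 j)).
  by apply: le_trans (ler_normD _ _) _; have := h2 j; lra.
pose K := 3 / 4 * (L * D) + 2 * (n%:R * (C * L)) + n%:R * (C * L) + 1 / 2 * (n%:R * (L * D * L)).
have LD0 : 0 <= L * D by rewrite mulr_ge0.
have CL0 : 0 <= n%:R * (C * L) by rewrite !mulr_ge0.
have LDL0 : 0 <= n%:R * (L * D * L) by rewrite mulr_ge0// mulr_ge0.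
have K0 : 0 <= K by rewrite /K; lra.
have sumb (p q : 'I_n -> R) (a b e : R) : (forall j, `|p j| <= a) -> (forall j, `|q j| <= b * e) ->
    `|\sum_j p j * q j| <= n%:R * (a * b) * e.
  move=> pa qb; apply: le_trans (ler_norm_sum _ _ _) _.
  apply: (@le_trans _ _ (\sum_(j < n) a * (b * e))).
    by apply: ler_sum => j _; rewrite normrM ler_pM.
  by rewrite sumr_const card_ord -[leLHS]mulr_natl !mulrA.
exists (K + n%:R * L) => y z By Bz; rewrite lee_fin.
rewrite eucl_distC (eucl_distC y); set e := eucl_dist z y.
have e0 : 0 <= e by exact: eucl_norm_ge0.
have eD : e <= D by exact: eucl_dist_ball_le.
have [h1 h2 h3] := HL y z By Bz; rewrite -/e in h1 h2 h3.
apply: le_trans (eucl_norm_le_sum _) _; rewrite big_ord_recl mulrDl.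
apply: lerD; last first.
  apply: (@le_trans _ _ (\sum_(j < n) L * e)).
    by apply: ler_sum => j _; rewrite !mxE liftK.
  by rewrite sumr_const card_ord -[leLHS]mulr_natl mulrA.
rewrite !mxE unlift_none heis_height_increment.
have b1 : `|- (3 / 4) * heis_twist (G y) (G z)| <= 3 / 4 * (L * D) * e.
  rewrite normrM normrN (@ger0_norm _ (3 / 4))// -[leRHS]mulrA ler_wpM2l//.
  by apply: le_trans h3 _; rewrite expr2 mulrA ler_wpM2r// ler_wpM2l.
have b2 : `|2 * \sum_j (G y).1.2 ord0 j * ((G z).1.1 ord0 j - (G y).1.1 ord0 j)|
    <= 2 * (n%:R * (C * L)) * e.
  rewrite normrM ger0_norm// -[leRHS]mulrA ler_wpM2l//; apply: sumb => // j.
  exact: (bnd y j By).2.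
have b3 : `|\sum_j (G y).1.1 ord0 j * ((G z).1.2 ord0 j - (G y).1.2 ord0 j)|
    <= n%:R * (C * L) * e.
  by apply: sumb => // j; exact: (bnd y j By).1.
have b4 : `|1 / 2 * \sum_j ((G z).1.1 ord0 j - (G y).1.1 ord0 j) *
    ((G z).1.2 ord0 j - (G y).1.2 ord0 j)| <= 1 / 2 * (n%:R * (L * D * L)) * e.
  rewrite normrM ger0_norm// -[leRHS]mulrA ler_wpM2l//; apply: sumb => // j.
  by apply: le_trans (h1 j) _; rewrite ler_wpM2l.
have B1 := le_trans (ler_normB _ _) (lerD b1 b2).
have B2 := le_trans (ler_normD _ _) (lerD B1 b3).
have B3 := le_trans (ler_normB _ _) (lerD B2 b4).
by apply: le_trans B3 _; rewrite /K !mulrDl.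
Qed.

Lemma eucl_norm_le_norm (R : realType) (d : nat) (x : 'rV[R]_d) :
  eucl_norm x <= d%:R * `|x|.
Proof.
apply: le_trans (eucl_norm_le_sum _) _.
apply: (@le_trans _ _ (\sum_(i < d) `|x|)).
  by apply: ler_sum => i _; exact: coord_le_mx_norm.
by rewrite sumr_const card_ord -[leLHS]mulr_natl.
Qed.

Lemma full_rank_set_heis_proj (R : realType) (m n : nat)
    (G : 'rV[R]_m.+1 -> heis R n) : contact_lipschitz (unit_ball R m) G ->
  full_rank_set (@heis_proj R n \o G) = set0.
Proof.
move=> [L L0 HL]; rewrite -subset0 => x [x1 dF rk] /=.
pose D : R := m.+1%:R ^+ 2.
have D1 : 1 <= D by rewrite exprn_ege1// ler1n.
have D0 : 0 < D by apply: lt_le_trans D1.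
pose r := (1 - eucl_norm x) / D.
have r0 : 0 < r by rewrite divr_gt0// subr_gt0.
have inB y : `|y - x| < r -> unit_ball R m y.
  rewrite ltr_pdivlMr// => yx; rewrite /unit_ball/=.
  have := le_trans (ler_norm _) (eucl_norm_lipschitz y x).
  have := ler_wpM2l (ler0n R m.+1) (eucl_norm_le_norm (y - x)).
  rewrite mulrA -expr2 -/D [leRHS]mulrC => h1 h2.
  have := le_lt_trans (le_trans h2 h1) yx.
  lra.
apply: (@rank_jacobian_heis_proj R _ n G _ x r (L * D)) rk => //.
- by rewrite mulr_ge0// ltW.
- move=> y z /inB By /inB Bz; have [h1 h2 h3] := HL y z By Bz.
  have e0 : 0 <= eucl_dist z y by exact: eucl_norm_ge0.
  have mD : m.+1%:R <= D by rewrite /D expr2 ler_peMr// ler1n.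
  have E : L * eucl_dist z y <= L * D * `|z - y|.
    rewrite -mulrA ler_wpM2l//; apply: le_trans (eucl_norm_le_norm _) _.
    by rewrite ler_wpM2r.
  split=> [j|j|]; [exact: le_trans (h1 j) E|exact: le_trans (h2 j) E|].
  apply: le_trans h3 _; rewrite -mulrA ler_wpM2l// /D -exprMn.
  by rewrite lerXn2r ?nnegrE ?mulr_ge0// eucl_norm_le_norm.
Qed.

Lemma lebesgue_outer_set0 (R : realType) (d : nat) :
  (@lebesgue_outer R d.+1 set0 <= 0)%E.
Proof.
apply: ereal_inf_lbound; exists (fun=> (0, 0)); first exact: sub0set.
apply: eseries0 => k _ _; rewrite /box_volume big_ord_recl /= !mxE subrr maxxx.
by rewrite mul0r.
Qed.

(** * Maps with continuous partial derivatives *)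

Lemma is_derive_of_lin_approx (R : realType) (f : R -> R) (x l : R) :
  (forall e : R, 0 < e -> exists2 d : R, 0 < d & forall y, `|y - x| < d ->
    `|f y - f x - (y - x) * l| <= e * `|y - x|) ->
  is_derive x 1 f l.
Proof.
move=> H.
have C : (fun h => h^-1 *: (f (h *: 1 + x) - f x)) @ 0^' --> l.
  apply/cvgrPdist_le => e e0; have [d d0 Hd] := H e e0.
  near=> h.
  have h0 : h != 0 by near: h; exact: nbhs_dnbhs_neq.
  have hd : `|h| < d by near: h; exact: dnbhs0_lt.
  have := Hd (h + x); rewrite addrK => /(_ hd) Hh.
  rewrite [h *: 1]mulr1 distrC -(ler_pM2r (_ : 0 < `|h|)) ?normr_gt0// -normrM.
  apply: le_trans Hh; rewrite le_eqVlt; apply/orP; left; apply/eqP; congr `|_|.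
  by rewrite /GRing.scale/=; field.
apply: DeriveDef; first by apply/cvg_ex; eexists; exact: C.
by rewrite /derive; apply/cvg_lim.
Unshelve. all: by end_near. Qed.

Lemma MVT_between (R : realType) (f df : R -> R) (a b : R) :
  (forall x, Num.min a b <= x <= Num.max a b -> is_derive x 1 f (df x)) ->
  exists2 c, Num.min a b <= c <= Num.max a b & f b - f a = df c * (b - a).
Proof.
wlog ab : a b / a <= b.
  move=> W H; case: (boolP (a <= b)) => [ab|]; first exact: W.
  rewrite -ltNge => /ltW ba; rewrite minC maxC in H *.
  have [c cab fc] := W b a ba H.
  by exists c => //; rewrite -opprB fc -mulrN opprB.
rewrite (min_idPl ab) (max_idPr ab) => H.
have [|//|c cab fc] := @MVT_segment R f df a b ab.
- by move=> x; rewrite in_itv/= => /andP[ax xb]; apply: H; rewrite !ltW.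
- apply: derivable_within_continuous => x; rewrite in_itv/= => xab.
  by have [] := H x xab.
- by exists c => //; move: cab; rewrite in_itv.
Qed.

Lemma mx_norm_le (R : realType) (m n : nat) (A : 'M[R]_(m, n)) (e : R) :
  0 <= e -> (forall i j, `|A i j| <= e) -> `|A| <= e.
Proof.
by move=> e0 H; rewrite /Num.Def.normr/= mx_normrE bigmax_le.
Qed.

(** Move from [y] to [z] by changing one coordinate at a time, and apply the mean
    value theorem to each move.  The intermediate points stay in the ball
    because it is a cube for the sup norm. *)
Lemma partial_telescope (R : realType) (d : nat) (f : 'rV[R]_d -> R)
    (x y z : 'rV[R]_d) (r : R) : 0 <= r ->
  (forall p, `|p - x| <= r -> forall k, derivable f p (delta_mx ord0 k)) ->
  `|y - x| <= r -> `|z - x| <= r ->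
  exists2 xi : 'I_d -> 'rV[R]_d, forall k, `|xi k - x| <= r &
    f z - f y = \sum_k 'D_(delta_mx ord0 k) f (xi k) * (z ord0 k - y ord0 k).
Proof.
move=> r0 df yx zx.
pose mix (k : nat) : 'rV[R]_d := \row_i (if (i < k)%N then z ord0 i else y ord0 i).
have step (k : 'I_d) : exists p, `|p - x| <= r /\
    f (mix k.+1) - f (mix k) = 'D_(delta_mx ord0 k) f p * (z ord0 k - y ord0 k).
  pose p t := (t - y ord0 k) *: delta_mx ord0 k + mix k.
  have pE t i : p t ord0 i = if i == k then t else mix k ord0 i.
    rewrite !mxE eqxx/=; case: eqP => [->|_]; last by rewrite mulr0 add0r.
    by rewrite ltnn mulr1 subrK.
  have py : p (y ord0 k) = mix k by rewrite /p subrr scale0r add0r.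
  have pz : p (z ord0 k) = mix k.+1.
    apply/rowP => i; rewrite pE !mxE.
    have -> : (i < k.+1)%N = (i == k) || (i < k)%N by rewrite ltnS leq_eqVlt.
    by case: eqP => [->|].
  have pr t : Num.min (y ord0 k) (z ord0 k) <= t <= Num.max (y ord0 k) (z ord0 k) ->
      `|p t - x| <= r.
    move=> tyz; apply: mx_norm_le => // i j; rewrite ord1 !mxE -/(p t).
    have yr := le_trans (coord_le_mx_norm (y - x) ord0 j) yx.
    have zr := le_trans (coord_le_mx_norm (z - x) ord0 j) zx.
    have := pE t j; rewrite !mxE => ->.
    move: yr zr; rewrite !mxE => yr zr; case: eqP => [jk|_]; last by case: ifP.
    move: yr zr tyz; rewrite jk !ler_norml ge_min le_max.
    by move=> /andP[? ?] /andP[? ?] /andP[/orP[] ? /orP[] ?]; apply/andP; split; lra.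
  have [|t tyz] := @MVT_between R (f \o p) (fun t => 'D_(delta_mx ord0 k) f (p t)) (y ord0 k) (z ord0 k).
    move=> t /pr tr; have dft := df _ tr k.
    have E : (fun h => h^-1 *: ((f \o p) (h *: 1 + t) - (f \o p) t)) =
             (fun h => h^-1 *: (f (h *: delta_mx ord0 k + p t) - f (p t))).
      apply/funext => h /=; congr (_ *: (f _ - _)).
      by rewrite /p [h *: 1]mulr1 -addrA scalerDl addrA.
    by apply: DeriveDef; rewrite /derivable/derive E.
  rewrite /= py pz => H; exists (p t); split => //; exact: pr.
pose xi k := projT1 (cid (step k)).
exists xi => [k|]; first by rewrite /xi; case: cid => p [].
have -> : f z - f y = \sum_(0 <= k < d) (f (mix k.+1) - f (mix k)).
  rewrite telescope_sumr//; congr (f _ - f _); apply/rowP => i; rewrite mxE//.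
  by rewrite ltn_ord.
rewrite big_mkord; apply: eq_bigr => k _; rewrite /xi.
by case: cid => p [].
Qed.

Lemma smooth_on_coord_derive (R : realType) (d n : nat) (U : set 'rV[R]_d)
    (g : 'rV[R]_d -> 'rV[R]_n) (l : 'I_n) : smooth_on U g ->
  forall p, U p -> forall k : 'I_d,
   derivable (fun q => g q ord0 l) p (delta_mx ord0 k) /\
   'D_(delta_mx ord0 k) (fun q => g q ord0 l) p = iter_partial [:: k] g p ord0 l.
Proof.
move=> sg p Up k; have [_ /(_ k) dg] := sg [::] p Up.
split; first by have /derivable_mxP := dg; apply.
by rewrite /= derive_mx// mxE.
Qed.

(** Strict differentiability: both ends of the increment vary.  Taking [e = 1]
    gives a local Lipschitz bound, and [e] small gives the chain rule along
    Lipschitz curves. *)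
Lemma smooth_on_approx (R : realType) (d n : nat) (U : set 'rV[R]_d)
    (g : 'rV[R]_d -> 'rV[R]_n) (x : 'rV[R]_d) (l : 'I_n) :
  open U -> U x -> smooth_on U g ->
  forall e : R, 0 < e -> exists2 r : R, 0 < r & forall y z, `|y - x| < r -> `|z - x| < r ->
    `|g z ord0 l - g y ord0 l -
       \sum_k iter_partial [:: k] g x ord0 l * (z ord0 k - y ord0 k)| <= e * `|z - y|.
Proof.
move=> oU Ux sg e e0.
have [r1 r10 Hr1] := open_norm_ball oU Ux.
pose e' := e / (d%:R + 1).
have d1 : 0 < d%:R + 1 :> R by rewrite ltr_wpDl.
have e'0 : 0 < e' by rewrite divr_gt0.
have : \forall p \near x, forall k, `|iter_partial [:: k] g x ord0 l - iter_partial [:: k] g p ord0 l| < e'.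
  apply: (@filter_forall _ 'I_d (fun k p =>
    `|iter_partial [:: k] g x ord0 l - iter_partial [:: k] g p ord0 l| < e') _ (nbhs_filter x)) => k.
  have [ck _] := sg [:: k] x Ux.
  move/cvgrPdist_lt : ck => /(_ _ e'0); apply: filterS => p H.
  apply: le_lt_trans H.
  by have := coord_le_mx_norm (iter_partial [:: k] g x - iter_partial [:: k] g p) ord0 l; rewrite !mxE.
move/nbhs_ballP => [r2 /= r20 Hr2].
exists (Num.min r1 r2); first by rewrite lt_min r10.
move=> y z yr zr.
pose r := Num.max `|y - x| `|z - x|.
have r0 : 0 <= r by rewrite le_max normr_ge0.
have rlt : r < Num.min r1 r2 by rewrite gt_max yr.
have [|||xi xir ->] := @partial_telescope R d (fun q => g q ord0 l) x y z r r0.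
- move=> p pr k; apply: (smooth_on_coord_derive l sg _ _).1.
  by apply: Hr1; apply: le_lt_trans pr _; apply: lt_le_trans rlt _; rewrite ge_min lexx.
- by rewrite le_max lexx.
- by rewrite le_max lexx orbT.
rewrite -sumrB; apply: le_trans (ler_norm_sum _ _ _) _.
apply: (@le_trans _ _ (\sum_(k < d) e' * `|z - y|)).
  apply: ler_sum => k _; rewrite -mulrBl normrM ler_pM//; last first.
    by have := coord_le_mx_norm (z - y) ord0 k; rewrite !mxE.
  have xk := le_lt_trans (xir k) rlt; move: xk; rewrite lt_min => /andP[xk1 xk2].
  rewrite (smooth_on_coord_derive l sg (Hr1 _ xk1) k).2 distrC ltW//.
  by apply: Hr2; rewrite -ball_normE/ball_/= distrC.
rewrite sumr_const card_ord -[leLHS]mulr_natl mulrA; apply: ler_wpM2r => //.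
by rewrite /e' mulrCA ger_pMr// ler_pdivrMr// mul1r lerDl.
Qed.

(** * Local Lipschitz bounds and derivatives along curves *)

Lemma smooth_on_local_lipschitz (R : realType) (d n : nat) (U : set 'rV[R]_d)
    (g : 'rV[R]_d -> 'rV[R]_n) (x : 'rV[R]_d) :
  open U -> U x -> smooth_on U g ->
  exists2 r : R, 0 < r & exists C : R, forall y z, `|y - x| < r -> `|z - x| < r ->
    forall l, `|g z ord0 l - g y ord0 l| <= C * `|z - y|.
Proof.
move=> oU Ux sg.
pose K l := \sum_k `|iter_partial [:: k] g x ord0 l|.
have K0 l : 0 <= K l by exact: sumr_ge0.
have : \forall r \near (0:R)^'+, forall l y z, `|y - x| < r -> `|z - x| < r ->
    `|g z ord0 l - g y ord0 l| <= (1 + K l) * `|z - y|.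
  apply: (@filter_forall R 'I_n (fun l r => forall y z, `|y - x| < r -> `|z - x| < r ->
    `|g z ord0 l - g y ord0 l| <= (1 + K l) * `|z - y|)) => l.
  have [r r0 Hr] := smooth_on_approx l oU Ux sg ltr01.
  near=> r' => y z yr zr.
  have rr' : r' < r by near: r'; exact: nbhs_right_lt.
  have {Hr} := Hr y z (lt_trans yr rr') (lt_trans zr rr').
  set S := \sum_k _ => Hr.
  have Sb : `|S| <= K l * `|z - y|.
    apply: le_trans (ler_norm_sum _ _ _) _; rewrite /K mulr_suml.
    apply: ler_sum => k _; rewrite normrM ler_wpM2l//.
    by have := coord_le_mx_norm (z - y) ord0 k; rewrite !mxE.
  rewrite -[X in `|X| <= _](subrK S); apply: le_trans (ler_normD _ _) _.
  by rewrite mulrDl lerD.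
move=> Hr.
have [r r0 {}Hr] : exists2 r : R, 0 < r & forall l y z, `|y - x| < r -> `|z - x| < r ->
    `|g z ord0 l - g y ord0 l| <= (1 + K l) * `|z - y|.
  near (0:R)^'+ => r; exists r => //; near: r; exact: Hr.
exists r => //; exists (1 + \sum_l K l) => y z yr zr l.
apply: le_trans (Hr l y z yr zr) _; rewrite ler_wpM2r// lerD2l.
by rewrite (bigD1 l)//= lerDl sumr_ge0.
Unshelve. all: by end_near. Qed.

(** Subtracting from g o c the linear part of g applied to c leaves a
    function with zero derivative, by [smooth_on_approx]. *)
Lemma smooth_on_derivable_along (R : realType) (d n : nat) (U : set 'rV[R]_d)
    (g : 'rV[R]_d -> 'rV[R]_n) (c : R -> 'rV[R]_d) (s K : R) (l : 'I_n) :
  open U -> U (c s) -> smooth_on U g -> 0 <= K ->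
  (forall s t, `|c s - c t| <= K * `|s - t|) ->
  (forall i, derivable (fun t => c t ord0 i) s 1) ->
  derivable (fun t => g (c t) ord0 l) s 1.
Proof.
move=> oU Ux sg K0 cK dc.
pose D k := iter_partial [:: k] g (c s) ord0 l.
pose psi : R -> R := \sum_k (D k \*: (fun t => c t ord0 k : R^o)).
have psiE t : psi t = \sum_k D k * c t ord0 k.
  by rewrite /psi fct_sumE; apply: eq_bigr => k _.
have dpsi : derivable psi s 1.
  by apply: derivable_sum => k; apply: derivableZ.
have dphi : is_derive s 1 (fun t => g (c t) ord0 l - psi t) 0.
  apply: is_derive_of_lin_approx => e e0.
  have e'0 : 0 < e / (K + 1) by rewrite divr_gt0// ltr_wpDl.
  have [r r0 Hr] := smooth_on_approx l oU Ux sg e'0.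
  exists (r / (K + 1)); first by rewrite divr_gt0// ltr_wpDl.
  move=> t; rewrite ltr_pdivlMr ?ltr_wpDl// => tr.
  have ctr : `|c t - c s| < r.
    apply: le_lt_trans tr; apply: le_trans (cK _ _) _.
    by rewrite mulrDr mulr1 mulrC lerDl.
  have css : `|c s - c s| < r by rewrite subrr normr0.
  have := Hr _ _ css ctr; rewrite mulr0 subr0.
  rewrite (_ : _ - \sum_k _ = g (c t) ord0 l - psi t - (g (c s) ord0 l - psi s)).
    move=> /le_trans; apply; rewrite -mulrA; apply: ler_wpM2l; first exact: ltW.
    rewrite mulrC ler_pdivrMr ?ltr_wpDl//; apply: le_trans (cK _ _) _.
    by rewrite mulrDr mulr1 mulrC lerDl.
  rewrite [X in _ - X](_ : _ = psi t - psi s); first by ring.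
  by rewrite !psiE -sumrB; apply: eq_bigr => k _; rewrite mulrBr.
rewrite (_ : (fun t => _) = (fun t => g (c t) ord0 l - psi t) + psi); last first.
  by apply/funext => t; rewrite /GRing.add/= subrK.
by apply: derivableD => //; case: dphi.
Qed.

Lemma derive1_le_of_local_lipschitz (R : realType) (f : R -> R) (s M : R) :
  derivable f s 1 ->
  (exists2 d : R, 0 < d & forall t, `|t - s| < d -> `|f t - f s| <= M * `|t - s|) ->
  `|derive1 f s| <= M.
Proof.
move=> df [d d0 Hd]; apply/ler_addgt0Pr => e e0.
have [d1 d10 Hd1] := derivable_lin_approx df e0.
pose h := Num.min d d1 / 2.
have h0 : 0 < h by rewrite divr_gt0// lt_min d0.
have hd : `|(s + h) - s| < d.
  rewrite addrC addKr gtr0_norm// /h ltr_pdivrMr//.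
  by rewrite (le_lt_trans (_ : _ <= d)) ?ge_min ?lexx// ltr_pMr// ltr1n.
have hd1 : `|(s + h) - s| < d1.
  rewrite addrC addKr gtr0_norm// /h ltr_pdivrMr//.
  by rewrite (le_lt_trans (_ : _ <= d1)) ?ge_min ?lexx ?orbT// ltr_pMr// ltr1n.
have := Hd1 _ hd1; have := Hd _ hd; rewrite (addrC s) addrK (gtr0_norm h0) => H1 H2.
rewrite -(ler_pM2r h0) -{1}(gtr0_norm h0) -normrM mulrDl.
rewrite (_ : derive1 f s * h = (f (h + s) - f s) - (f (h + s) - f s - h *: derive1 f s)).
  by apply: le_trans (ler_normB _ _) _; rewrite lerD.
by rewrite /GRing.scale/=; ring.
Qed.

Lemma continuous_eucl_norm (R : realType) (d : nat) : continuous (@eucl_norm R d).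
Proof.
move=> x; apply/(@cvgrPdist_lt _ _ _ (nbhs x) (nbhs_filter x)) => e e0.
have D0 : 0 < d%:R * d%:R + 1 :> R by rewrite ltr_wpDl// mulr_ge0.
apply/nbhs_ballP; exists (e / (d%:R * d%:R + 1)); first by rewrite /= divr_gt0.
move=> y; rewrite -ball_normE/ball_/= ltr_pdivlMr// => xy.
apply: le_lt_trans (eucl_norm_lipschitz _ _) _.
apply: le_lt_trans (ler_wpM2l (ler0n _ _) (eucl_norm_le_norm _)) _.
by rewrite mulrA; apply: le_lt_trans xy; rewrite mulrDr mulr1 mulrC lerDl.
Qed.

Lemma compact_unit_sphere (R : realType) (m : nat) : compact (unit_sphere R m).
Proof.
apply: bounded_closed_compact.
  exists 1; split => // M M1 x; rewrite /unit_sphere/= => x1.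
  apply: mx_norm_le => [|i j]; first by rewrite (le_trans ler01)// ltW.
  by rewrite ord1 (le_trans (coord_le_eucl_norm x j))// x1 ltW.
apply: (@preimage_closed _ _ (@eucl_norm R m.+1) [set 1]); last first.
  exact: closed_eq.
by move=> x _; exact: continuous_eucl_norm.
Qed.

(** Compactness of the sphere makes the local Lipschitz constants uniform.  The
    radius may depend on the point, which suffices to bound derivatives along
    curves. *)
Lemma smooth_sphere_map_local_lipschitz (R : realType) (m n : nat)
    (f : 'rV[R]_m.+1 -> 'rV[R]_n.+1) : smooth_sphere_map f ->
  exists2 C : R, 0 <= C & forall x, unit_sphere R m x -> exists2 r : R, 0 < r &
    forall y z, unit_sphere R m y -> unit_sphere R m z ->
      `|y - x| < r -> `|z - x| < r -> forall l, `|f z ord0 l - f y ord0 l| <= C * `|z - y|.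
Proof.
move=> [_ fS].
pose P (C : R) x := exists2 r : R, 0 < r &
    forall y z, unit_sphere R m y -> unit_sphere R m z ->
      `|y - x| < r -> `|z - x| < r -> forall l, `|f z ord0 l - f y ord0 l| <= C * `|z - y|.
have := (compact_near_coveringP _).1 (@compact_unit_sphere R m) _ _ P (@proper_pinfty_nbhs R).
move=> H.
have {}H : \forall C \near +oo, unit_sphere R m `<=` P C.
  apply: H => x Sx; have [U [g [oU Ux sg gf]]] := fS x Sx.
  have [r r0 [C HC]] := smooth_on_local_lipschitz oU Ux sg.
  have [r1 r10 Hr1] := open_norm_ball oU Ux.
  pose r2 := Num.min r r1 / 2.
  have r20 : 0 < r2 by rewrite divr_gt0// lt_min r0.
  exists ([set p | `|p - x| < r2], [set C' | C <= C']) => /=.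
    split; last by exists C; split; [exact: num_real|move=> M /ltW].
    by apply/nbhs_ballP; exists r2 => //= p; rewrite -ball_normE/ball_/= distrC.
  move=> [x' C'] /= [x'x CC'].
  exists r2 => // y z Sy Sz yx' zx' l.
  have close p : `|p - x'| < r2 -> `|p - x| < Num.min r r1.
    move=> px; rewrite -(subrKA x') (le_lt_trans (ler_normD _ _))//.
    by rewrite (splitr (Num.min r r1)) ltrD.
  have := close _ yx'; have := close _ zx'; rewrite !lt_min => /andP[z1 z2] /andP[y1 y2].
  rewrite -(gf y)//; last exact: Hr1.
  rewrite -(gf z)//; last exact: Hr1.
  apply: le_trans (HC _ _ y1 z1 l) _; exact: ler_wpM2r.
near (pinfty_nbhs R) => C.
exists C; first by near: C; exact: nbhs_pinfty_ge.
by near: C; exact: H.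
Unshelve. all: by end_near. Qed.

(** * Great circles *)

Lemma unit_sphere_sum (R : realType) (d : nat) (x : 'rV[R]_d.+1) :
  unit_sphere R d x <-> \sum_i x ord0 i ^+ 2 = 1.
Proof.
rewrite /unit_sphere/=; split=> [x1|x1]; first by rewrite -eucl_normK x1 expr1n.
by rewrite /eucl_norm x1 sqrtr1.
Qed.

Definition dotp (R : realType) (d : nat) (x y : 'rV[R]_d) : R :=
  \sum_i x ord0 i * y ord0 i.

Lemma unit_sphereN (R : realType) (d : nat) (x : 'rV[R]_d.+1) :
  unit_sphere R d x -> unit_sphere R d (- x).
Proof.
move=> /unit_sphere_sum x1; apply/unit_sphere_sum; rewrite -x1.
by apply: eq_bigr => i _; rewrite mxE sqrrN.
Qed.

Lemma dotpN (R : realType) (d : nat) (x y : 'rV[R]_d) : dotp x (- y) = - dotp x y.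
Proof. by rewrite /dotp -sumrN; apply: eq_bigr => i _; rewrite mxE mulrN. Qed.

Lemma eucl_distE (R : realType) (d : nat) (x y : 'rV[R]_d.+1) :
  unit_sphere R d x -> unit_sphere R d y ->
  eucl_dist x y ^+ 2 = 2 - 2 * dotp x y.
Proof.
move=> /unit_sphere_sum x1 /unit_sphere_sum y1; rewrite eucl_normK.
rewrite (_ : 2 - _ = \sum_i x ord0 i ^+ 2 + \sum_i y ord0 i ^+ 2 - 2 * dotp x y); last first.
  by rewrite x1 y1.
rewrite /dotp mulr_sumr -big_split -sumrB.
by apply: eq_bigr => i _; rewrite /= !mxE; ring.
Qed.

(** Stated for the normalised remainder, so that [z] is recovered at the angle
    whose cosine is [dotp x z]. *)
Lemma gram_schmidt (R : realType) (d : nat) (x z : 'rV[R]_d.+1) :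
  unit_sphere R d x -> unit_sphere R d z -> dotp x z ^+ 2 < 1 ->
  exists e, [/\ unit_sphere R d e, dotp x e = 0 &
    z = dotp x z *: x + Num.sqrt (1 - dotp x z ^+ 2) *: e].
Proof.
move=> /unit_sphere_sum x1 /unit_sphere_sum z1.
have [c cE] : exists c, dotp x z = c by eexists.
rewrite !cE => c1.
have q0 : 0 < Num.sqrt (1 - c ^+ 2) by rewrite sqrtr_gt0 subr_gt0.
have q2 : Num.sqrt (1 - c ^+ 2) ^+ 2 = 1 - c ^+ 2 by rewrite sqr_sqrtr// subr_ge0 ltW.
set q := Num.sqrt _ in q0 q2 *.
exists (q^-1 *: (z - c *: x)); split.
- apply/unit_sphere_sum.
  transitivity (q^-1 ^+ 2 * (\sum_i z ord0 i ^+ 2 - 2 * c * dotp x z + c ^+ 2 * \sum_i x ord0 i ^+ 2)).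
    rewrite /dotp !mulr_sumr -sumrB -big_split mulr_sumr.
    by apply: eq_bigr => i _; rewrite /= !mxE; ring.
  rewrite z1 x1 cE (_ : 1 - 2 * c * c + c ^+ 2 * 1 = q ^+ 2); last by rewrite q2; ring.
  by rewrite -exprMn mulVf ?expr1n// gt_eqF.
- transitivity (q^-1 * (dotp x z - c * \sum_i x ord0 i ^+ 2)).
    rewrite /dotp mulr_sumr -sumrB mulr_sumr.
    by apply: eq_bigr => i _; rewrite /= !mxE; ring.
  by rewrite x1 cE mulr1 subrr mulr0.
- by rewrite scalerA divff ?gt_eqF// scale1r addrC subrK.
Qed.

Lemma dotp_bounds (R : realType) (d : nat) (x y : 'rV[R]_d.+1) :
  unit_sphere R d x -> unit_sphere R d y -> -1 <= dotp x y <= 1.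
Proof.
move=> Sx Sy; have Dxy := eucl_distE Sx Sy.
have DNxy := eucl_distE Sx (unit_sphereN Sy).
have := sqr_ge0 (eucl_dist x y); have := sqr_ge0 (eucl_dist x (- y)).
by rewrite Dxy DNxy dotpN => ? ?; apply/andP; split; lra.
Qed.

(** For antipodal points any unit vector orthogonal to [x] works, and one is
    obtained from a coordinate vector that is not parallel to [x]; this is where
    the sphere must have positive dimension. *)
Lemma exists_unit_orthogonal (R : realType) (m : nat) (x y : 'rV[R]_m.+1) :
  (1 <= m)%N -> unit_sphere R m x -> unit_sphere R m y -> x != y ->
  exists e, [/\ unit_sphere R m e, dotp x e = 0 &
    y = dotp x y *: x + Num.sqrt (1 - dotp x y ^+ 2) *: e].
Proof.
move=> m1 Sx Sy xy; have /andP[c1 c2] := dotp_bounds Sx Sy.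
have Dxy := eucl_distE Sx Sy.
have D0 : 0 < eucl_dist x y by rewrite lt_def eucl_dist0 xy eucl_norm_ge0.
have D20 : 0 < eucl_dist x y ^+ 2 by rewrite exprn_gt0.
have c3 : dotp x y < 1 by lra.
have [c4|c4] := ltP (-1) (dotp x y).
  apply: gram_schmidt => //; nra.
have cE : dotp x y = -1 by apply: le_anti; rewrite c4.
have SNx := unit_sphereN Sx.
have yx : y = - x.
  apply/eqP; rewrite -eucl_dist0 -sqrf_eq0 eucl_distE//.
  rewrite (_ : dotp y (- x) = 1); first by apply/eqP; lra.
  have dC : dotp y x = dotp x y.
    by rewrite /dotp; apply: eq_bigr => i _; rewrite mulrC.
  by rewrite dotpN dC cE opprK.
have /unit_sphere_sum x1 := Sx.
pose i1 : 'I_m.+1 := lift ord0 (Ordinal m1).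
have [i xi] : exists i, x ord0 i ^+ 2 < 1.
  have [x0|x0] := ltP (x ord0 ord0 ^+ 2) 1; first by exists ord0.
  exists i1; move: x1; rewrite (bigD1 ord0)//= (bigD1 i1)//=.
  set S := \sum_(_ | _) _; have S0 : 0 <= S by apply: sumr_ge0 => j _; exact: sqr_ge0.
  lra.
pose z : 'rV[R]_m.+1 := delta_mx ord0 i.
have Sz : unit_sphere R m z by exact: unit_sphere_delta.
have dz : dotp x z = x ord0 i.
  rewrite /dotp (bigD1 i)//= big1 => [|j ji]; first by rewrite mxE !eqxx addr0 mulr1.
  by rewrite mxE (negbTE ji) mulr0.
have [|e [Se xe _]] := gram_schmidt Sx Sz; first by rewrite dz.
exists e; split => //.
by rewrite cE sqrrN expr1n subrr sqrtr0 scale0r addr0 scaleN1r.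
Qed.

(** The geodesic distance on the sphere is comparable to the chord.  For angles
    with cosine at most 1/2 the chord is at least 1; for smaller angles compare
    with the sine by the mean value theorem. *)
Lemma acos_le_eucl_dist (R : realType) (d : nat) (x y : 'rV[R]_d.+1) :
  unit_sphere R d x -> unit_sphere R d y -> acos (dotp x y) <= 4 * eucl_dist x y.
Proof.
move=> Sx Sy; have cb := dotp_bounds Sx Sy; have /andP[c1 c2] := cb.
have Dxy := eucl_distE Sx Sy; have D0 : 0 <= eucl_dist x y by exact: eucl_norm_ge0.
set c := dotp x y in cb c1 c2 Dxy *; set D := eucl_dist x y in Dxy D0 *.
have th0 : 0 <= acos c by exact: acos_ge0.
have thpi : acos c <= pi by exact: acos_lepi.
have [c12|c12] := leP c (1 / 2).
  have D1 : 1 <= D.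
    rewrite leNgt; apply/negP => D1.
    have : D ^+ 2 < 1 by rewrite exprn_ilt1.
    lra.
  have := @pihalf_lt2 R; lra.
have sD : sin (acos c) <= D.
  rewrite sin_acos// -[leRHS]ger0_norm// -sqrtr_sqr; apply: ler_wsqrtr; nra.
have [th|th] := leP (acos c) 0; first by rewrite (le_trans th)// mulr_ge0.
have [xi xin] := @MVT R sin cos 0 (acos c) th (fun t _ => is_derive_sin t)
   (continuous_subspaceT (@continuous_sin R)).
rewrite sin0 !subr0 => E.
have cxi : 1 / 2 < cos xi.
  apply: (lt_trans c12); move: xin; rewrite in_itv/= => /andP[xi0 xith].
  rewrite -{1}(@acosK R c) ?in_itv//= ltr_cos// in_itv/= ?th0//.
  by rewrite (ltW xi0) (le_trans (ltW xith)).
have : 1 / 2 * acos c <= sin (acos c) by rewrite E ler_wpM2r// ltW.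
lra.
Qed.

(** A curve defined on the whole line, so that derivatives at the end points
    need no special treatment. *)
Lemma great_circle (R : realType) (m : nat) (x y : 'rV[R]_m.+1) :
  (1 <= m)%N -> unit_sphere R m x -> unit_sphere R m y -> x != y ->
  exists (th : R) (c : R -> 'rV[R]_m.+1),
    [/\ 0 < th <= 4 * eucl_dist x y, c 0 = x, c th = y &
        forall s, [/\ unit_sphere R m (c s), forall t, `|c s - c t| <= 2 * `|s - t| &
          forall i, derivable (fun t => c t ord0 i) s 1]].
Proof.
move=> m1 Sx Sy xy; have [e [Se xe ye]] := exists_unit_orthogonal m1 Sx Sy xy.
have cb := dotp_bounds Sx Sy; have /andP[c1 c2] := cb.
have Dxy := eucl_distE Sx Sy.
have D0 : 0 < eucl_dist x y ^+ 2.
  by rewrite exprn_gt0// lt_def eucl_dist0 xy eucl_norm_ge0.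
pose c t := cos t *: x + sin t *: e.
have dc (i : 'I_m.+1) (s : R) : is_derive s 1 (fun t => c t ord0 i) (- sin s * x ord0 i + cos s * e ord0 i).
  have -> : (fun t => c t ord0 i) = (x ord0 i \*: (@cos R : R -> R^o)) + (e ord0 i \*: (@sin R : R -> R^o)).
    by apply/funext => t; rewrite !mxE /GRing.add/= /GRing.scale/= [x ord0 i * _]mulrC [e ord0 i * _]mulrC.
  by apply: is_derive_eq; rewrite /GRing.scale/=; ring.
have coord1 z i : unit_sphere R m z -> `|z ord0 i| <= 1.
  by move=> Sz; rewrite -Sz; exact: coord_le_eucl_norm.
exists (acos (dotp x y)), c; split.
- rewrite acos_le_eucl_dist// andbT acos_gt0// c1/=; lra.
- by rewrite /c cos0 sin0 scale1r scale0r addr0.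
- by rewrite /c acosK ?in_itv// sin_acos// -ye.
- move=> s; split.
  + apply/unit_sphere_sum; move/unit_sphere_sum : Sx => x1; move/unit_sphere_sum : Se => e1.
    transitivity (cos s ^+ 2 * (\sum_i x ord0 i ^+ 2) + 2 * cos s * sin s * dotp x e +
       sin s ^+ 2 * (\sum_i e ord0 i ^+ 2)).
      rewrite /dotp !mulr_sumr -!big_split; apply: eq_bigr => i _.
      by rewrite /= !mxE; ring.
    by rewrite x1 e1 xe !mulr1 mulr0 addr0 cos2Dsin2.
  + move=> t; apply: mx_norm_le => [|i j]; first by rewrite mulr_ge0.
    rewrite ord1; have [u _ E] := @MVT_between R (fun t => c t ord0 j)
      (fun s => - sin s * x ord0 j + cos s * e ord0 j) t s (fun u _ => dc j u).
    have Ec (u' v' : 'rV[R]_m.+1) : (u' - v') ord0 j = u' ord0 j - v' ord0 j.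
      by rewrite !mxE.
    rewrite Ec E normrM ler_wpM2r//.
    apply: le_trans (ler_normD _ _) _; rewrite !normrM normrN.
    have a1 : `|sin u| * `|x ord0 j| <= 1 * 1 by rewrite ler_pM// ?sin_max// coord1.
    have a2 : `|cos u| * `|e ord0 j| <= 1 * 1 by rewrite ler_pM// ?cos_max// coord1.
    lra.
  + by move=> i; case: (dc i s).
Qed.

(** * The Legendrian sphere *)

(** The first two components form the Whitney immersion, a Lagrangian immersion of
    the sphere into C^n whose only double point identifies the two poles; the
    last component is the lift that makes it horizontal and separates them. *)
Definition legendre_sphere (R : realType) (n : nat) (x : 'rV[R]_n.+1) : heis R n :=
  (\row_j x ord0 (lift ord0 j), \row_j (x ord0 ord0 * x ord0 (lift ord0 j)),
   - 2 * (x ord0 ord0 - x ord0 ord0 ^+ 3 / 3)).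

Lemma unit_sphere_tail (R : realType) (n : nat) (x : 'rV[R]_n.+1) :
  unit_sphere R n x -> \sum_j x ord0 (lift ord0 j) ^+ 2 = 1 - x ord0 ord0 ^+ 2.
Proof.
by move=> /unit_sphere_sum; rewrite big_ord_recl => <-; rewrite addrC addKr.
Qed.

Lemma legendre_sphereK (R : realType) (n : nat) (x : 'rV[R]_n.+1) :
  unit_sphere R n x -> heis_proj (legendre_sphere x) = x.
Proof.
move=> Sx; apply/rowP => i; rewrite mxE; case: unliftP => [j ->|->].
  by rewrite mxE.
rewrite /heis_height /=.
rewrite (_ : \sum_j _ = x ord0 ord0 * \sum_j x ord0 (lift ord0 j) ^+ 2); last first.
  by rewrite mulr_sumr; apply: eq_bigr => j _; rewrite !mxE; ring.
rewrite unit_sphere_tail//; lra.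
Qed.

Lemma heis_norm_le (R : realType) (n : nat) (p : heis R n) (e : R) : 0 <= e ->
  (forall j, `|p.1.1 ord0 j| <= e) -> (forall j, `|p.1.2 ord0 j| <= e) ->
  `|p.2| <= e -> `|p| <= e.
Proof.
move=> e0 pu pv pt; rewrite prod_normE ge_max pt andbT prod_normE ge_max.
by rewrite !mx_norm_le// => i j; rewrite ord1.
Qed.

Lemma heis_derivable (R : realType) (n : nat) (c : R -> heis R n) (s : R)
    (d : heis R n) :
  (forall j, is_derive s 1 (fun t => (c t).1.1 ord0 j) (d.1.1 ord0 j)) ->
  (forall j, is_derive s 1 (fun t => (c t).1.2 ord0 j) (d.1.2 ord0 j)) ->
  is_derive s 1 (fun t => (c t).2 : R) d.2 ->
  derivable c s 1 /\ derive1 c s = d.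
Proof.
move=> du dv dt.
have lim (f : R -> R) (l : R) : is_derive s 1 f l ->
    forall e : R, 0 < e -> \forall h \near (0:R)^', `|l - h^-1 * (f (h + s) - f s)| <= e.
  move=> [df fl] e e0; move: df; rewrite /derivable => /cvg_ex[l' cl'].
  have ll' : l' = l by rewrite -fl /derive; apply/esym/cvg_lim.
  move/cvgrPdist_le : cl' => /(_ _ e0); apply: filterS => h.
  by rewrite ll' [h *: 1]mulr1.
have C : (fun h => h^-1 *: (c (h *: 1 + s) - c s)) @ 0^' --> d.
  apply/cvgrPdist_le => e e0.
  have hu : \forall h \near (0:R)^', forall j,
      `|d.1.1 ord0 j - h^-1 * ((c (h + s)).1.1 ord0 j - (c s).1.1 ord0 j)| <= e.
    apply: (@filter_forall R 'I_n (fun j h =>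
      `|d.1.1 ord0 j - h^-1 * ((c (h + s)).1.1 ord0 j - (c s).1.1 ord0 j)| <= e)) => j.
    exact: (lim _ _ (du j)).
  have hv : \forall h \near (0:R)^', forall j,
      `|d.1.2 ord0 j - h^-1 * ((c (h + s)).1.2 ord0 j - (c s).1.2 ord0 j)| <= e.
    apply: (@filter_forall R 'I_n (fun j h =>
      `|d.1.2 ord0 j - h^-1 * ((c (h + s)).1.2 ord0 j - (c s).1.2 ord0 j)| <= e)) => j.
    exact: (lim _ _ (dv j)).
  have ht := lim _ _ dt e e0.
  near=> h; rewrite [h *: 1]mulr1; apply: heis_norm_le; first exact: ltW.
  - by move=> j; rewrite /= !mxE; move: j; near: h.
  - by move=> j; rewrite /= !mxE; move: j; near: h.
  - by near: h.
split; first by apply/cvg_ex; exists d.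
by rewrite derive1E /derive; apply/cvg_lim.
Unshelve. all: by end_near. Qed.

Lemma heis_mul_t (R : realType) (n : nat) (g q : heis R n) :
  (heis_mul g q).2 = g.2 + (q.2 - 2 * \sum_j
    ((heis_inv g).1.2 ord0 j * q.1.1 ord0 j - (heis_inv g).1.1 ord0 j * q.1.2 ord0 j)).
Proof.
rewrite /heis_mul /= -addrA; congr (_ + (_ + _)); rewrite -mulrN -sumrN.
by congr (_ * _); apply: eq_bigr => j _; rewrite !mxE; ring.
Qed.

Lemma heis_mul_derivable (R : realType) (n : nat) (g : heis R n)
    (c : R -> heis R n) (s : R) : derivable c s 1 ->
  derivable (fun t => heis_mul g (c t)) s 1 /\
  derive1 (fun t => heis_mul g (c t)) s =
   ((derive1 c s).1.1, (derive1 c s).1.2, (derive1 c s).2 +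
    2 * \sum_j (g.1.2 ord0 j * (derive1 c s).1.1 ord0 j - g.1.1 ord0 j * (derive1 c s).1.2 ord0 j)).
Proof.
move=> dc.
have der (l : heis R n -> R) (k : R) : bounded_functional l ->
    is_derive s 1 (fun t => k + l (c t)) (l (derive1 c s)).
  move=> bl; have [dl lE] := bounded_functional_derive bl dc.
  have H : is_derive s 1 (l \o c) (l (derive1 c s)).
    by apply: DeriveDef => //; rewrite -derive1E.
  rewrite -[X in is_derive _ _ _ X]add0r.
  exact: (@is_deriveD _ _ _ (cst k) (l \o c)).
apply: heis_derivable => [j|j|]; rewrite /=.
- rewrite (_ : (fun t => _) = (fun t => g.1.1 ord0 j + (fun q : heis R n => q.1.1 ord0 j) (c t))); last first.
    by apply/funext => t; rewrite mxE.
  by apply: (der (fun q : heis R n => q.1.1 ord0 j)); exact: bounded_functional_x.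
- rewrite (_ : (fun t => _) = (fun t => g.1.2 ord0 j + (fun q : heis R n => q.1.2 ord0 j) (c t))); last first.
    by apply/funext => t; rewrite mxE.
  by apply: (der (fun q : heis R n => q.1.2 ord0 j)); exact: bounded_functional_y.
- have := der _ g.2 (bounded_functional_twist (heis_inv g)).
  set f := (X in is_derive _ _ X _ -> _); set d := (X in is_derive _ _ _ X -> _).
  set d' := (X in _ -> is_derive _ _ _ X).
  rewrite (_ : d = d'); last first.
    by apply: (addrI g.2); rewrite /d -heis_mul_t /d' /heis_mul /= addrA.
  by rewrite (_ : f = fun t => (heis_mul g (c t)).2)//; apply/funext => t; rewrite heis_mul_t.
Qed.

Lemma legendre_sphere_derivable (R : realType) (n : nat) (c : R -> 'rV[R]_n.+1)
    (s : R) : (forall i, derivable (fun t => c t ord0 i) s 1) ->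
  let a := c s ord0 ord0 in let a' := derive1 (fun t => c t ord0 ord0) s in
  derivable (fun t => legendre_sphere (c t)) s 1 /\
  derive1 (fun t => legendre_sphere (c t)) s =
   (\row_j derive1 (fun t => c t ord0 (lift ord0 j)) s,
    \row_j (a' * c s ord0 (lift ord0 j) + a * derive1 (fun t => c t ord0 (lift ord0 j)) s),
    - 2 * ((1 - a ^+ 2) * a')).
Proof.
move=> dc a a'.
have D i : is_derive s 1 (fun t => c t ord0 i) (derive1 (fun t => c t ord0 i) s).
  by apply: DeriveDef; rewrite ?derive1E.
apply: heis_derivable => [j|j|] /=.
- rewrite mxE (_ : (fun t => _) = (fun t => c t ord0 (lift ord0 j)))//.
  by apply/funext => t; rewrite mxE.
- rewrite mxE (_ : (fun t => _) = (fun t => c t ord0 ord0) * (fun t => c t ord0 (lift ord0 j))).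
    by apply: is_derive_eq; rewrite /a /a' /GRing.scale/=; ring.
  by apply/funext => t; rewrite mxE.
- rewrite (_ : (fun t => _) = (-2) \*: ((fun t => c t ord0 ord0) -
     3^-1 \*: ((fun t => c t ord0 ord0) ^+ 3) : R -> R^o)).
    by apply: is_derive_eq; rewrite /a /a' /GRing.scale/=; field.
  by apply/funext => t; rewrite !fctE/= /GRing.scale/=; congr (_ * (_ - _)); rewrite mulrC.
Qed.

(** The contact condition reduces to (1 - a^2) a' = |X|^2 a', which follows from
    the equation of the sphere. *)
Lemma legendre_curve_horizontal (R : realType) (n : nat) (g : heis R n)
    (c : R -> 'rV[R]_n.+1) (s : R) : unit_sphere R n (c s) ->
  (forall i, derivable (fun t => c t ord0 i) s 1) ->
  let k := fun t => heis_mul g (legendre_sphere (c t)) in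
  derivable k s 1 /\ horizontal (k s) (derive1 k s).
Proof.
move=> Sc dc k.
have [dl lE] := legendre_sphere_derivable dc.
have [dk kE] := heis_mul_derivable g dl; split => //.
rewrite /horizontal kE lE.
do 2 eexists; rewrite heis_frameE; congr (_, _, _) => /=.
have tail := unit_sphere_tail Sc.
set a := c s ord0 ord0 in tail *; set a' := derive1 _ _.
rewrite -tail.
rewrite (_ : - 2 * ((\sum_j c s ord0 (lift ord0 j) ^+ 2) * a') =
  2 * \sum_j - (c s ord0 (lift ord0 j) ^+ 2 * a')); last first.
  by rewrite sumrN mulr_suml; ring.
rewrite -mulrDr -big_split; congr (2 * _); apply: eq_bigr => j _.
by rewrite /= !mxE -/a -/a'; ring.
Qed.

Lemma heis_norm_le_sum (R : realType) (n : nat) (v : heis R n) :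
  heis_norm v <= \sum_j (`|v.1.1 ord0 j| + `|v.1.2 ord0 j|).
Proof.
pose w : 'rV[R]_n := \row_j (`|v.1.1 ord0 j| + `|v.1.2 ord0 j|).
have := eucl_norm_le_sum w; rewrite [leRHS](_ : _ =
    \sum_j (`|v.1.1 ord0 j| + `|v.1.2 ord0 j|)); last first.
  by apply: eq_bigr => j _; rewrite mxE ger0_norm// addr_ge0.
apply: le_trans; apply: ler_wsqrtr; apply: ler_sum => j _; rewrite mxE.
rewrite -(real_normK (num_real (v.1.1 ord0 j))) -(real_normK (num_real (v.1.2 ord0 j))).
by rewrite sqrrD lerD2r lerDl mulrn_wge0// mulr_ge0.
Qed.

(** The coordinates of a point of the sphere are at most 1, so that the speed of
    the image curve is bounded by a multiple of [M] independent of the curve and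
    of the translation [g]. *)
Lemma dcc_legendre_curve_le (R : realType) (n : nat) (g : heis R n)
    (c : R -> 'rV[R]_n.+1) (M a b : R) : 0 <= M -> a < b ->
  (forall s, unit_sphere R n (c s)) ->
  (forall s i, derivable (fun t => c t ord0 i) s 1) ->
  (forall s i, `|derive1 (fun t => c t ord0 i) s| <= M) ->
  (dcc (heis_mul g (legendre_sphere (c a))) (heis_mul g (legendre_sphere (c b)))
    <= (3 * n%:R * M * (b - a))%:E)%E.
Proof.
move=> M0 ab Sc dc dM.
pose l t := legendre_sphere (c t).
pose k t := heis_mul g (l t).
have dl s := legendre_sphere_derivable (dc s).
have dk s := heis_mul_derivable g (dl s).1.
have c1 s i : `|c s ord0 i| <= 1 by rewrite -(Sc s); exact: coord_le_eucl_norm.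
have c2 s : `|1 - c s ord0 ord0 ^+ 2| <= 1.
  rewrite -unit_sphere_tail// ger0_norm ?sumr_ge0// => [|j _]; last exact: sqr_ge0.
  by rewrite unit_sphere_tail// gerBl sqr_ge0.
have du s j : `|(derive1 l s).1.1 ord0 j| <= M by rewrite (dl s).2 mxE.
have dv s j : `|(derive1 l s).1.2 ord0 j| <= 2 * M.
  rewrite (dl s).2 mxE; apply: le_trans (ler_normD _ _) _; rewrite !normrM.
  have h1 := ler_pM (normr_ge0 _) (normr_ge0 _) (dM s ord0) (c1 s (lift ord0 j)).
  have h2 := ler_pM (normr_ge0 _) (normr_ge0 _) (c1 s ord0) (dM s (lift ord0 j)).
  lra.
have dt s : `|(derive1 l s).2| <= 2 * M.
  rewrite (dl s).2 /= normrM normrN (@ger0_norm _ 2)//; apply: ler_wpM2l => //.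
  by rewrite normrM -[leRHS]mul1r ler_pM.
have M20 : 0 <= 2 * M by rewrite mulr_ge0.
have lipl (f : heis R n -> R) (K : R) s t : bounded_functional f ->
    (forall u, `|f (derive1 l u)| <= K) -> `|f (l s) - f (l t)| <= K * `|s - t|.
  move=> bf fK; have [|u _ E] := @MVT_between R (f \o l) (fun u => f (derive1 l u)) t s.
    move=> u _; have [dfl dfE] := bounded_functional_derive bf (dl u).1.
    by apply: DeriveDef => //; rewrite -derive1E.
  by move: E => /= ->; rewrite normrM ler_wpM2r.
have bt := bounded_functional_twist (heis_inv g).
have [K K0 HK] := (let: And3 _ _ H := bt in H).
have dlM s : `|derive1 l s| <= 2 * M.
  by apply: heis_norm_le => // j; apply: le_trans (du s j) _; lra.
have lipk s t : `|k s - k t| <= (2 * M + K * (2 * M)) * `|s - t|.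
  have KM : 0 <= K * (2 * M) by rewrite mulr_ge0// ltW.
  have st : 0 <= `|s - t| by [].
  apply: heis_norm_le => [|j|j|].
  - by rewrite mulr_ge0// addr_ge0.
  - rewrite /= !mxE opprD addrACA subrr add0r.
    have := lipl _ _ s t (bounded_functional_x R j) (fun u => du u j); rewrite /l !mxE => /le_trans; apply.
    by rewrite ler_wpM2r//; lra.
  - rewrite /= !mxE opprD addrACA subrr add0r.
    have := lipl _ _ s t (bounded_functional_y R j) (fun u => dv u j); rewrite /l !mxE => /le_trans; apply.
    by rewrite ler_wpM2r//; lra.
  - rewrite [X in `|X|](_ : _ = (k s).2 - (k t).2)// /k !heis_mul_t opprD addrACA subrr add0r.
    apply: le_trans (lipl _ (K * (2 * M)) s t bt _) _.
      by move=> u; apply: le_trans (HK _) _; rewrite ler_wpM2l// ltW.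
    by rewrite ler_wpM2r// lerDr.
have hk : horizontal_curve a b k.
  split.
    move=> e e0; pose L := 2 * M + K * (2 * M).
    have L0 : 0 <= L by rewrite addr_ge0// mulr_ge0// ltW.
    exists (e / (L + 1)); first by rewrite divr_gt0// ltr_wpDl.
    move=> N u v uv _; rewrite ltr_pdivlMr ?ltr_wpDl// => sumlt.
    apply: le_lt_trans sumlt; rewrite mulr_suml; apply: ler_sum => i _.
    apply: le_trans (lipk _ _) _; have [_ [uvi _]] := uv i.
    rewrite ger0_norm ?subr_ge0// mulrC ler_wpM2l ?subr_ge0//.
    by rewrite /L lerDl.
  exists set0; split; rewrite ?measure0//.
  by move=> s /= H; apply: H => _; exact: legendre_curve_horizontal.
apply: (@le_trans _ _ (curve_length a b k)).
  by apply: ereal_inf_lbound; exists a, b, k.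
rewrite /curve_length.
apply: (@le_trans _ _ (\int[@lebesgue_measure R]_(s in `]a, b[%classic) (3 * n%:R * M)%:E)%E).
  apply: le_ge0_integral => s.
  - by move=> _; rewrite lee_fin; exact: sqrtr_ge0.
  - by move=> _; rewrite lee_fin !mulr_ge0.
  - move=> sab; split=> //; rewrite lee_fin; apply: le_trans (heis_norm_le_sum _) _.
    apply: (@le_trans _ _ (\sum_(j < n) 3 * M)).
      apply: ler_sum => j _; rewrite (dk s).2 /=.
      have := du s j; have := dv s j; lra.
    by rewrite sumr_const card_ord -[leLHS]mulr_natl; lra.
rewrite integral_cst//= lebesgue_measure_itv/= lte_fin ab.
by rewrite -EFinB -EFinM.
Qed.

(** Great circles transport the local Lipschitz bound on [f] to a global bound
    for the Carnot-Caratheodory distance, which as an infimum over curves would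
    otherwise require gluing curves. *)
Lemma legendre_sphere_lipschitz (R : realType) (m n : nat) (g : heis R n)
    (f : 'rV[R]_m.+1 -> 'rV[R]_n.+1) : (1 <= m)%N -> smooth_sphere_map f ->
  exists2 L : R, 0 <= L & forall x y, unit_sphere R m x -> unit_sphere R m y ->
    (dcc (heis_mul g (legendre_sphere (f x))) (heis_mul g (legendre_sphere (f y)))
      <= (L * eucl_dist x y)%:E)%E.
Proof.
move=> m1 sf; have [C C0 HC] := smooth_sphere_map_local_lipschitz sf.
case: sf => fS floc.
exists (3 * n%:R * (C * 2) * 4); first by rewrite !mulr_ge0.
move=> x y Sx Sy; have [<-|xy] := eqVneq x y.
  have dc (s : R) i : derivable (fun=> f x ord0 i) s 1 by exact: derivable_cst.
  have d0 (s : R) i : `|derive1 (fun=> f x ord0 i) s| <= 0 by rewrite derive1_cst normr0.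
  have := @dcc_legendre_curve_le R n g (fun=> f x) 0 0 1 (lexx _) ltr01
    (fun=> fS _ Sx) dc d0.
  rewrite mulr0 mul0r => /le_trans; apply; rewrite lee_fin.
  by rewrite !mulr_ge0// eucl_norm_ge0.
have [th [c [/andP[th0 thD] c0 cth Hc]]] := great_circle m1 Sx Sy xy.
have CM : 0 <= C * 2 by rewrite mulr_ge0.
have dfc (s : R) i : derivable (fun t => f (c t) ord0 i) s 1.
  have [Sc lc dc] := Hc s.
  have [U [h [oU Us sh hf]]] := floc _ Sc.
  have := @smooth_on_derivable_along _ _ _ U h c s 2 i oU Us sh (ler0n R 2)
    (fun s t => (let: And3 _ H _ := Hc s in H) t) dc.
  apply: near_eq_derivable.
  have [r r0 Hr] := open_norm_ball oU Us.
  apply/nbhs_ballP; exists (r / 2) => /=; first by rewrite divr_gt0.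
  move=> t; rewrite /ball/= => st; rewrite hf//; last by have [] := Hc t.
  apply: Hr; rewrite distrC; apply: le_lt_trans (lc t) _.
  by rewrite mulrC -ltr_pdivlMr.
have dM (s : R) i : `|derive1 (fun t => f (c t) ord0 i) s| <= C * 2.
  apply: derive1_le_of_local_lipschitz => //.
  have [Sc lc _] := Hc s; have [r r0 Hr] := HC _ Sc.
  exists (r / 2); first by rewrite divr_gt0.
  move=> t ts; have [St lt _] := Hc t.
  have css : `|c s - c s| < r by rewrite subrr normr0.
  have cts : `|c t - c s| < r.
    by apply: le_lt_trans (lt s) _; rewrite mulrC -ltr_pdivlMr.
  apply: le_trans (Hr _ _ Sc St css cts i) _.
  by rewrite -mulrA ler_wpM2l.
have := @dcc_legendre_curve_le R n g (f \o c) (C * 2) 0 th CM th0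
  (fun s => fS _ (let: And3 H _ _ := Hc s in H)) dfc dM.
rewrite /= c0 cth subr0 => /le_trans; apply; rewrite lee_fin -[leRHS]mulrA.
by rewrite ler_wpM2l// !mulr_ge0.
Qed.

(** * Nontriviality of the homotopy group *)

(** The projection of [G] would be a Lipschitz extension of [f] to the ball with
    empty [full_rank_set]. *)
Lemma not_rank_essential_of_contact_extension (R : realType) (m n : nat)
    (f : 'rV[R]_m.+1 -> 'rV[R]_n.+1) (G : 'rV[R]_m.+1 -> heis R n) :
  (forall F : 'rV[R]_m.+1 -> 'rV[R]_n.+1,
      lipschitz_wrt (@eucl_dist R m.+1) (fun y z => (eucl_dist y z)%:E)
        (unit_ball R m) F ->
      (forall x, unit_sphere R m x -> F x = f x) ->
      (0 < lebesgue_outer (full_rank_set F))%E) ->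
  contact_lipschitz (unit_ball R m) G ->
  (forall x, unit_sphere R m x -> heis_proj (G x) = f x) -> False.
Proof.
move=> ess cG Gf; have := ess _ (heis_proj_lipschitz cG) Gf.
by rewrite full_rank_set_heis_proj// ltNge lebesgue_outer_set0.
Qed.

Lemma based_lip_homotopic_refl (R : realType) (X : Type)
    (dX : X -> X -> \bar R) (m : nat) (x0 : X) (f : 'rV[R]_m.+1 -> X) (L : R) :
  0 <= L ->
  (forall x y, unit_sphere R m x -> unit_sphere R m y ->
     (dX (f x) (f y) <= (L * eucl_dist x y)%:E)%E) ->
  f (sphere_base R m) = x0 -> based_lip_homotopic dX x0 f f.
Proof.
move=> L0 HL fb; exists (f \o fst); split => //.
exists L => -[x s] [y t] [/= Sx _] [/= Sy _]; apply: le_trans (HL x y Sx Sy) _.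
by rewrite lee_fin ler_wpM2l// cyl_dist_eucl.
Qed.

Theorem theorem1p5 (R : realType) (m n : nat) (hm : (1 <= m)%N)
    (hn : (1 <= n)%N) (hess : rank_essential R m n) (p0 : heis R n) :
  pi_lip (@dcc R n) m p0 <> [set pi_lip0 (@dcc R n) m p0].
Proof.
move=> triv; case: hess => f [sf ess].
(* The left translation that sends the base point of the lifted sphere to [p0]. *)
pose g := heis_mul p0 (heis_inv (legendre_sphere (f (sphere_base R m)))).
pose phi x := heis_mul g (legendre_sphere (f x)).
have [L L0 HL] := legendre_sphere_lipschitz g hm sf.
have phib : phi (sphere_base R m) = p0 by exact: heis_mulK.
have phiL : based_lip_map (@dcc R n) p0 phi by split => //; exists L.
have : pi_lip (@dcc R n) m p0 (lip_class (@dcc R n) p0 phi) by exists phi.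
rewrite triv /= => phi0.
have [_ hom] : pi_lip0 (@dcc R n) m p0 phi.
  by rewrite -phi0; split => //; exact: based_lip_homotopic_refl L0 HL phib.
have [G [GL Gphi]] := cone_of_null_homotopy hom.
apply: (not_rank_essential_of_contact_extension ess
  (contact_lipschitz_mul (heis_inv g) (contact_lipschitz_dcc GL))) => x Sx /=.
by rewrite Gphi// heis_mulKV legendre_sphereK//; exact: sf.1.
Qed.
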